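(* Let $\mathcal{L}$ be a Banach Lie algebra. Then the following conditions are equivalent: (i) $\mathcal{L}$ is $\mathcal{F}$-semisimple, i.e. $\mathcal{F}(\mathcal{L})=\{0\}$. (ii) $\mathcal{L}$ has a complete, lower finite-gap chain of closed Lie $2$-step subideals from $\{0\}$ to $\mathcal{L}$. (iii) $\mathcal{L}$ has a complete, lower finite-gap chain of closed Lie subalgebras from $\{0\}$ to $\mathcal{L}$. (iv) The set of all closed Lie $2$-step subideals of $\mathcal{L}$ is a $\mathfrak{p}$-complete, lower finite-gap family. (v) The set of all closed Lie subalgebras of $\mathcal{L}$ is a $\mathfrak{p}$-complete, lower finite-gap family.
   Context: A Banach Lie algebra is a complex Lie algebra $\mathcal{L}$ which is a Banach space in a norm such that, for some $t_{\mathcal{L}}>0$, $\|[a,b]\|\leq t_{\mathcal{L}}\|a\|\|b\|$ for all $a,b\in\mathcal{L}$. Frattini radical. $P_{\mathfrak{J}}(\mathcal{L})$ is the intersection of all proper closed Lie ideals of finite codimension in $\mathcal{L}$ (and equals $\mathcal{L}$ if there are none). Put $P_{\mathfrak{J}}^{0}(\mathcal{L})=\mathcal{L}$, $P_{\mathfrak{J}}^{\alpha+1}(\mathcal{L})=P_{\mathfrak{J}}(P_{\mathfrak{J}}^{\alpha}(\mathcal{L}))$, $P_{\mathfrak{J}}^{\alpha}(\mathcal{L})=\bigcap_{\alpha'<\alpha}P_{\mathfrak{J}}^{\alpha'}(\mathcal{L})$ for limit ordinals $\alpha$; $\mathcal{F}(\mathcal{L})$ is the value at which this decreasing transfinite sequence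 of closed Lie ideals stabilizes. (The same $\mathcal{F}$ is obtained if proper closed ideals of finite codimension are replaced by proper closed subalgebras of finite codimension, or by maximal proper closed subalgebras, or maximal proper closed ideals, of finite codimension.) A Lie subalgebra $I$ of $\mathcal{L}$ is a $2$-step Lie subideal if it is a Lie ideal of some Lie ideal of $\mathcal{L}$. Families of subspaces. For a non-empty family $G$ of closed subspaces of a Banach space, $\mathfrak{p}(G)=\bigcap_{Y\in G}Y$ and $\mathfrak{s}(G)$ is the closed linear span of $\bigcup_{Y\in G}Y$. $G$ is $\mathfrak{p}$-complete if $G=\{\mathfrak{p}(G'):\varnothing\neq G'\subseteq G\}\cup\{\mathfrak{s}(G)\}$; $G$ is $\mathfrak{s}$-complete if $G=\{\mathfrak{s}(G'):\varnothing\neq G'\subseteq G\}\cup\{\mathfrak{p}(G)\}$; complete means both. $G$ is a lower finite-gap family if for each $Z\in G$ with $Z\neq\mathfrak{p}(G)$ there is $Y\in G$ with $Y\subset Z$ and $0<\dim(Z/Y)<\infty$. A chain is a family $C$ totally ordered by inclusion; it is a chain from $A$ to $B$ if $\mathfrak{p}(C)=A$ and $\mathfrak{s}(C)=B$. *)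

(* Defs.v *)
From HB Require Import structures.
From mathcomp Require Import all_boot all_order all_algebra.
From mathcomp Require Import complex.
From mathcomp Require Import all_classical all_reals all_analysis.
From mathcomp Require wochoice.
Set Implicit Arguments.
Unset Strict Implicit.
Unset Printing Implicit Defensive.
Import Order.TTheory GRing.Theory Num.Theory.
Import numFieldNormedType.Exports.
Local Open Scope classical_set_scope.
Local Open Scope ring_scope.
Local Open Scope complex_scope.

(* The norm of a normed module over R[i] takes its values in R[i], and 0 < t
   in R[i] means that t is a positive real. *)
HB.mixin Record isBanachLie (R : realType) L
    of CompleteNormedModule R[i] L := {
  bracket : L -> L -> L ;
  bracketDl : forall (k : R[i]) (a b c : L),
    bracket (k *: a + b) c = k *: bracket a c + bracket b c ;
  bracketDr : forall (k : R[i]) (a b c : L),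
    bracket c (k *: a + b) = k *: bracket c a + bracket c b ;
  bracketxx : forall a : L, bracket a a = 0 ;
  bracket_jacobi : forall a b c : L,
    bracket a (bracket b c) + bracket b (bracket c a)
      + bracket c (bracket a b) = 0 ;
  bracket_bounded : exists2 t : R[i], 0 < t &
    forall a b : L, `|bracket a b| <= t * `|a| * `|b|
}.

#[short(type="banachLieType")]
HB.structure Definition BanachLie (R : realType) :=
  { L of isBanachLie R L & CompleteNormedModule R[i] L }.

Section Subspaces.
Context (K : numFieldType) (V : normedModType K).
Implicit Types (X Y Z : set V) (G C : set (set V)).

Definition is_subspace X := submod_closed [in X].

(* For subspaces Y of Z: the classes of e 0, ..., e (n - 1) form a basis
   of Z / Y. *)
Definition quotient_dim Z Y (n : nat) :=
  exists2 e : 'I_n -> V, (forall i, Z (e i)) &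
    forall z, Z z -> exists! c : 'rV[K]_n, Y (z - \sum_i c 0 i *: e i).

Definition finite_codim Z Y := exists n, quotient_dim Z Y n.

Definition finite_gap Z Y := exists2 n, (0 < n)%N & quotient_dim Z Y n.

Definition closed_span X := closure (smallest is_subspace X).

Definition fam_inf G : set V := \bigcap_(Y in G) Y.

Definition fam_sup G : set V := closed_span (\bigcup_(Y in G) Y).

Definition p_complete G :=
  G = [set fam_inf G' | G' in [set G' | G' !=set0 /\ G' `<=` G]]
      `|` [set fam_sup G].

Definition s_complete G :=
  G = [set fam_sup G' | G' in [set G' | G' !=set0 /\ G' `<=` G]]
      `|` [set fam_inf G].

Definition complete_family G := p_complete G /\ s_complete G.

Definition lower_finite_gap G :=
  forall Z, G Z -> Z <> fam_inf G ->
    exists Y, [/\ G Y, Y `<` Z & finite_gap Z Y].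

Definition chain_from_to C (A B : set V) :=
  [/\ C !=set0, total_on C subset, fam_inf C = A & fam_sup C = B].

End Subspaces.

Section WellOrderedIndices.
Context (W : eqType) (le : rel W).

Definition wo_lt (a b : W) := le a b /\ a <> b.

Definition wo_zero (a : W) := forall b, le a b.

Definition wo_succ (a b : W) := wo_lt a b /\ forall c, wo_lt a c -> le b c.

Definition wo_limit (a : W) :=
  (exists b, wo_lt b a) /\
  forall b, wo_lt b a -> exists c, wo_lt b c /\ wo_lt c a.

End WellOrderedIndices.

Section LieSubspaces.
Context (R : realType) (L : banachLieType R).
Implicit Types (I J M X : set L).

Definition lie_subalgebra M :=
  is_subspace M /\ forall a b, M a -> M b -> M (bracket a b).

Definition lie_ideal M I :=
  [/\ is_subspace I, I `<=` M & forall a b, M a -> I b -> I (bracket a b)].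

Definition two_step_subideal I :=
  lie_subalgebra I /\ exists2 J, lie_ideal setT J & lie_ideal J I.

(* P_J(M) for a closed subalgebra M of L, regarded as a Banach Lie algebra;
   since M is closed, subsets of M closed in M are those closed in L.
   The outer M makes the intersection of the empty family equal to M. *)
Definition PJ M : set L :=
  M `&` \bigcap_(I in [set I | [/\ lie_ideal M I, closed I, I <> M
                                 & finite_codim M I]]) I.

(* S is the family (P_J^alpha(L)), where alpha ranges over an initial segment
   of the ordinals, presented as a well-ordered type (W, le). *)
Definition PJ_sequence (W : eqType) (le : rel W) (S : W -> set L) :=
  [/\ forall a, wo_zero le a -> S a = setT,
      forall a b, wo_succ le a b -> S b = PJ (S a)
    & forall a, wo_limit le a -> S a = \bigcap_(b in [set b | wo_lt le b a]) S b].

Definition PJ_term X :=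
  exists (W : eqType) (le : rel W) (S : W -> set L),
    [/\ wochoice.well_order le, PJ_sequence le S & exists a, S a = X].

(* The term P_J^alpha(L) at which the sequence stabilizes, i.e. with
   P_J^(alpha + 1)(L) = P_J^alpha(L). *)
Definition frattini_radical : set L := get [set X | PJ_term X /\ PJ X = X].

Definition frattini_semisimple := frattini_radical = [set 0].

End LieSubspaces.

Arguments frattini_semisimple {R} L.

(* Main.v *)
(* The crux is that a Banach Lie algebra [A] with a proper closed subalgebra [M]
   of finite codimension has a proper closed ideal of finite codimension; all
   implications from chains and gap conditions back to semisimplicity follow.

   Take [M] maximal and let [level n] be the set of [c] such that all iterated
   brackets [x_1, ..., [x_k, c]] with [k < n] lie in [M]. Up to the action of
   [M] these are symmetric in the [x_i], so the [level n / level (n + 1)] form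
   the dual of a finitely generated graded module [N] over the symmetric algebra
   of [A / M]. Let [W / M] be the subspace of the vectors of [A / M] acting
   nilpotently on [N]; it is [M]-invariant. If [W = A], then [N] is
   finite-dimensional and some [level n] is an ideal. Otherwise every [m] in [M]
   acts nilpotently on [A / W]: if [x] is an eigenvector of [m] modulo [W] with
   eigenvalue [lam <> 0], then [x ^ p] does not annihilate [N / W N], so [m] has
   eigenvalues on subquotients of [A] that differ by [p * lam], for every [p],
   although [ad m] is bounded. By Engel's theorem there is a hyperplane [H] with
   [W <= H] and [[M, A] <= H]. As [dim (H / M) < dim (A / M)], some [r] outside
   [M] normalizes [H]; the normalizer of [H] is a subalgebra containing [M], so
   it is [A], and [H] is an ideal.

   The transfinite sequences and the chain in (ii) are both obtained as the
   smallest family of sets closed under intersections and under a decreasing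
   step map; such a family is well-ordered by reverse inclusion. *)
Require Import Defs.
From HB Require Import structures.
From mathcomp Require Import all_boot all_order all_algebra.
From mathcomp Require Import complex zify.
From mathcomp Require Import all_classical all_reals all_analysis.
From mathcomp Require wochoice.
Set Implicit Arguments.
Unset Strict Implicit.
Unset Printing Implicit Defensive.
Import Order.TTheory GRing.Theory Num.Theory.
Import numFieldNormedType.Exports.
Local Open Scope classical_set_scope.
Local Open Scope ring_scope.
Local Open Scope complex_scope.

(** * Subspaces of finite codimension *)

Lemma row_kernel (K : fieldType) n (A : 'M[K]_(n.+1, n)) :
  exists2 r : 'rV[K]_n.+1, r != 0 & r *m A = 0.
Proof.
have: kermx A != 0.
  by rewrite -mxrank_eq0 mxrank_ker -lt0n subn_gt0 ltnS rank_leq_col.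
by case/rowV0Pn => r /sub_kermxP rA r0; exists r.
Qed.

Lemma linear_comb (K : pzRingType) (V V' : lmodType K) (f : V -> V') n
    (c : 'I_n -> K) (z : 'I_n -> V) : linear f ->
  f (\sum_i c i *: z i) = \sum_i c i *: f (z i).
Proof.
move=> lf; elim/big_rec2: _ => [|i y x _ <-]; last by rewrite lf.
by have := lf (-1) 0 0; rewrite !scaleN1r !addNr.
Qed.

Definition subsp (K : fieldType) (V : lmodType K) (X : set V) :=
  X 0 /\ forall a u v, X u -> X v -> X (a *: u + v).

(** For subspaces this bounds the dimension of [Z] modulo its intersection with [Y]. Stated by
    dependence of any n + 1 vectors, it needs neither a basis nor [Y] inside [Z], and passes
    directly to smaller [Z] and to linear preimages and images. *)
Definition codim_le (K : fieldType) (V : lmodType K) (Z Y : set V) n :=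
  forall z : 'I_n.+1 -> V, (forall i, Z (z i)) ->
    exists2 c : 'rV[K]_n.+1, c != 0 & Y (\sum_i c 0 i *: z i).

Definition fcodim (K : fieldType) (V : lmodType K) (Z Y : set V) :=
  exists n, codim_le Z Y n.

Section LinearMaps.
Context (K : fieldType) (V V' : lmodType K) (f : V -> V').
Hypothesis lf : linear f.

Lemma linear_sub u v : f (u - v) = f u - f v.
Proof. by have := lf (-1) v u; rewrite !scaleN1r ![- _ + _]addrC. Qed.

Lemma subsp_preim X : subsp X -> subsp (f @^-1` X).
Proof.
move=> [X0 hX]; split=> [|a u v]; rewrite /preimage /=; last first.
  by rewrite lf; apply: hX.
by have := lf (-1) 0 0; rewrite !scaleN1r !addNr => ->.
Qed.

Lemma subsp_image X : subsp X -> subsp (f @` X).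
Proof.
move=> [X0 hX]; split=> [|a _ _ [u Xu <-] [v Xv <-]]; last first.
  by exists (a *: u + v); [apply: hX|rewrite lf].
by exists 0 => //; have := lf (-1) 0 0; rewrite !scaleN1r !addNr.
Qed.

Lemma fcodim_preim Z Y Z' : (forall z, Z' z -> Z (f z)) -> fcodim Z Y ->
  fcodim Z' (f @^-1` Y).
Proof.
move=> fZ [n h]; exists n => z Zz; have [i|c c0 Yc] := h (f \o z);
  first exact/fZ.
by exists c => //; rewrite /preimage /= linear_comb.
Qed.

Lemma fcodim_image Z Y : fcodim Z Y -> fcodim (f @` Z) (f @` Y).
Proof.
move=> [n h]; exists n => z Zz.
have /choice[z' Zz'] i : exists z', Z z' /\ f z' = z i.
  by have [z' ? ?] := Zz i; exists z'.
have [i|c c0 Yc] := h z'.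
  by have [] := Zz' i.
exists c => //; exists (\sum_i c 0 i *: z' i) => //.
by rewrite linear_comb//; apply: eq_bigr => i _; have [_ ->] := Zz' i.
Qed.

End LinearMaps.

Section FiniteCodimension.
Context (K : fieldType) (V : lmodType K).
Implicit Types (X Y Z : set V).

Lemma subspD X u v : subsp X -> X u -> X v -> X (u + v).
Proof. by move=> [_ h] Xu Xv; rewrite -[u]scale1r; apply: h. Qed.

Lemma subspZ X a u : subsp X -> X u -> X (a *: u).
Proof. by move=> [h0 h] Xu; rewrite -[_ *: _]addr0; apply: h. Qed.

Lemma subspN X u : subsp X -> X u -> X (- u).
Proof. by move=> sX Xu; rewrite -scaleN1r; apply: subspZ. Qed.

Lemma subspB X u v : subsp X -> X u -> X v -> X (u - v).
Proof. by move=> sX Xu Xv; apply: subspD => //; apply: subspN. Qed.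

Lemma subspBr X u v : subsp X -> X (u - v) -> X v -> X u.
Proof. by move=> sX Xuv Xv; rewrite -[u](subrK v); apply: subspD. Qed.

Lemma subspBl X u v : subsp X -> X (u - v) -> X u -> X v.
Proof. by move=> sX Xuv Xv; rewrite -[v](subKr u); apply: subspB. Qed.

Lemma subspZK X a u : subsp X -> a != 0 -> X (a *: u) -> X u.
Proof. by move=> sX a0 /(subspZ a^-1 sX); rewrite scalerA mulVf// scale1r. Qed.

Lemma subsp_sum X (I : Type) (r : seq I) (F : I -> V) :
  subsp X -> (forall i, X (F i)) -> X (\sum_(i <- r) F i).
Proof.
move=> sX XF; elim/big_rec: _ => [|i u _ Xu]; first by case: sX.
exact: subspD.
Qed.

Lemma subspI X Y : subsp X -> subsp Y -> subsp (X `&` Y).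
Proof.
move=> [X0 hX] [Y0 hY]; split=> // a u v [? ?] [? ?].
by split; [apply: hX|apply: hY].
Qed.

Lemma subsp_bigcap (I : Type) (D : set I) (F : I -> set V) :
  (forall i, D i -> subsp (F i)) -> subsp (\bigcap_(i in D) F i).
Proof.
move=> sF; split=> [i /sF[]//|a u v Fu Fv i Di].
by case: (sF i Di) => _; apply; [apply: Fu|apply: Fv].
Qed.

Definition add_line Y z := [set y + c *: z | y in Y & c in [set: K]].

Lemma add_lineP Y z u : add_line Y z u <-> exists c, Y (u - c *: z).
Proof.
split=> [[y Yy [c _ <-]]|[c Yu]]; first by exists c; rewrite addrK.
by exists (u - c *: z) => //; exists c => //; rewrite subrK.
Qed.

Lemma sub_add_line Y z : Y `<=` add_line Y z.
Proof. by move=> y Yy; exists y => //; exists 0 => //;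
  rewrite scale0r addr0. Qed.

Lemma add_line_in Y z : subsp Y -> add_line Y z z.
Proof.
by move=> [Y0 _]; exists 0 => //; exists 1 => //; rewrite scale1r add0r.
Qed.

Lemma subsp_add_line Y z : subsp Y -> subsp (add_line Y z).
Proof.
move=> sY; split=> [|a u v /add_lineP[c Yc] /add_lineP[d Yd]].
  by apply: sub_add_line; case: sY.
apply/add_lineP; exists (a * c + d).
rewrite (_ : _ - _ = a *: (u - c *: z) + (v - d *: z)).
  by apply: subspD => //; apply: subspZ.
by rewrite scalerDl scalerBr scalerA opprD addrACA.
Qed.

Lemma codim_leS Z Y Z' Y' n : subsp Z' -> Z' `<=` Z -> Z' `&` Y `<=` Y' ->
  codim_le Z Y n -> codim_le Z' Y' n.
Proof.
move=> sZ' ZZ' YY' h z Zz; have [i|c c0 Yc] := h z; first exact/ZZ'.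
by exists c => //; apply: YY'; split=> //; apply: subsp_sum => // i;
  apply: subspZ.
Qed.

Lemma fcodimS Z Y Z' Y' : subsp Z' -> Z' `<=` Z -> Z' `&` Y `<=` Y' ->
  fcodim Z Y -> fcodim Z' Y'.
Proof. by move=> ? ? ? [n ?]; exists n; apply: codim_leS; eauto. Qed.

(** The coordinates of n + 1 vectors form a matrix with n columns; a row in its left kernel gives
    the combination. *)
Lemma spanning_codim_le Z Y n (e : 'I_n -> V) : subsp Y ->
  (forall z, Z z -> exists c : 'rV[K]_n, Y (z - \sum_i c 0 i *: e i)) ->
  codim_le Z Y n.
Proof.
move=> sY span z Zz; have /choice[C hC] i := span _ (Zz i).
have [r r0 rA] := row_kernel (\matrix_i C i); exists r => //.
rewrite (_ : \sum_i _ =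
  \sum_i r 0 i *: (z i - \sum_j C i 0 j *: e j)).
  by apply: subsp_sum => // i; apply: subspZ.
under [RHS]eq_bigr do rewrite scalerBr scaler_sumr.
rewrite sumrB exchange_big/= [X in _ = _ - X]big1 ?subr0// => j _.
under eq_bigr do rewrite scalerA.
have /rowP/(_ j) := rA; rewrite !mxE => rAj.
rewrite -scaler_suml [X in X *: _](_ : _ = 0) ?scale0r// -[RHS]rAj.
by apply: eq_bigr => i _; rewrite mxE.
Qed.

(** Prepend [a] to the given vectors: a relation modulo [Y] cannot involve [a] alone. This drop
    drives the inductions on codimension below. *)
Lemma codim_le_grow Z Y Y' a n : Z a -> Y `<=` Y' -> subsp Y -> subsp Y' ->
  Y' a -> ~ Y a -> codim_le Z Y n -> (0 < n)%N /\ codim_le Z Y' n.-1.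
Proof.
move=> Za YY' sY sY' Y'a Ya; case: n => [|n] h.
  have [//|c c0] := h (fun=> a).
  rewrite big_ord1 => /subspZK; case/(_ sY _)/Ya.
  by apply: contraNneq c0 => c0; apply/eqP/rowP => i; rewrite mxE !ord1.
split=> // z Zz.
have [i|c c0] := h (fun i => if unlift ord0 i is Some j then z j else a).
  by case: unlift.
rewrite big_ord_recl unlift_none; under eq_bigr do rewrite liftK.
move=> Yc; exists (\row_i c 0 (lift ord0 i)).
  apply: contraNneq c0 => /rowP c0.
  move: Yc; rewrite big1 ?addr0 => [Yc|i _]; last first.
    by have := c0 i; rewrite !mxE => ->; rewrite scale0r.
  have [c00|/subspZK h0] := eqVneq (c 0 ord0) 0; last by case: Ya; apply: h0 Yc.
  apply/eqP/rowP => i; rewrite mxE; case: (unliftP ord0 i) => [j|] -> //.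
  by have := c0 j; rewrite !mxE.
under eq_bigr do rewrite mxE.
apply: (subspBl (u := - (c 0 ord0 *: a))) => //.
  by rewrite -opprD; apply: subspN => //; exact: YY'.
by apply: subspN => //; exact: subspZ.
Qed.

Lemma codim_le_basis Z Y n : subsp Z -> subsp Y -> codim_le Z Y n ->
  exists k (e : 'I_k -> V), [/\ forall i, Z (e i),
    forall c : 'rV[K]_k, Y (\sum_i c 0 i *: e i) -> c = 0
  & forall z, Z z -> exists c : 'rV[K]_k, Y (z - \sum_i c 0 i *: e i)].
Proof.
move=> sZ; elim: n Y => [|n IH] Y sY hY;
  have [ZY|/existsNP[a /not_implyP[Za Ya]]] := pselect (Z `<=` Y).
- exists 0%N, (fun=> 0); split=> [[]//|c _|z /ZY Yz].
    by apply/rowP => -[].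
  by exists 0; rewrite big_ord0 subr0.
- have [] := codim_le_grow Za (@sub_add_line Y a) sY (subsp_add_line _ sY)
    (add_line_in _ sY) Ya hY.
  by [].
- exists 0%N, (fun=> 0); split=> [[]//|c _|z /ZY Yz].
    by apply/rowP => -[].
  by exists 0; rewrite big_ord0 subr0.
have [_ /= /(IH _ (subsp_add_line _ sY))[k [e [Ze indep span]]]] :=
  codim_le_grow Za (@sub_add_line Y a) sY (subsp_add_line _ sY)
    (add_line_in _ sY) Ya hY.
exists k.+1, (fun i => if unlift ord0 i is Some j then e j else a); split.
- by move=> i; case: unlift.
- move=> c; rewrite big_ord_recl unlift_none; under eq_bigr do rewrite liftK.
  move=> Yc.
  have /rowP c0 : \row_i c 0 (lift ord0 i) = 0.
    apply: indep; under eq_bigr do rewrite mxE.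
    by apply/add_lineP; exists (- c 0 ord0); rewrite scaleNr opprK addrC.
  have {}c0 i : c 0 (lift ord0 i) = 0 by have := c0 i; rewrite !mxE.
  move: Yc; rewrite big1 ?addr0 => [Yc|i _]; last by rewrite c0 scale0r.
  have [c00|/subspZK h0] := eqVneq (c 0 ord0) 0; last by case: Ya; apply: h0 Yc.
  by apply/rowP => i; rewrite mxE; case: (unliftP ord0 i) => [j|] ->.
move=> z /span[c /add_lineP[d]]; rewrite -addrA -opprD addrC => Yz.
exists (\row_i (if unlift ord0 i is Some j then c 0 j else d)).
rewrite big_ord_recl unlift_none mxE unlift_none.
under eq_bigr do rewrite mxE liftK.
by rewrite addrC [X in - X]addrC.
Qed.

Lemma fcodim_trans Z Y X : subsp Z -> subsp Y -> subsp X ->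
  fcodim Z Y -> fcodim Y X -> fcodim Z X.
Proof.
move=> sZ sY sX [n /codim_le_basis[//|//|k [e [_ _ he]]]].
move=> [m /codim_le_basis[//|//|l [f [_ _ hf]]]].
exists (k + l)%N.
pose ef i := match fintype.split i with inl j => e j | inr j => f j end.
apply: (@spanning_codim_le _ _ _ ef) => //.
move=> z /he[c /hf[d h]]; exists (row_mx c d).
rewrite big_split_ord/= opprD addrA /ef.
rewrite (eq_bigr (fun i => c 0 i *: e i)) => [|i _]; last first.
  by rewrite row_mxEl (unsplitK (inl _)).
rewrite [X in _ - X](eq_bigr (fun i => d 0 i *: f i))// => i _.
by rewrite row_mxEr (unsplitK (inr _)).
Qed.

Lemma fcodimxx Y : subsp Y -> fcodim Y Y.
Proof.
move=> sY; exists 0%N; apply: (@spanning_codim_le _ _ _ (fun=> 0)) => // z Yz.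
by exists 0; rewrite big_ord0 subr0.
Qed.

Lemma fcodimI Z Y1 Y2 : subsp Z -> subsp Y1 -> subsp Y2 -> Y1 `<=` Z ->
  fcodim Z Y1 -> fcodim Z Y2 -> fcodim Z (Y1 `&` Y2).
Proof.
move=> sZ s1 s2 Y1Z f1 f2; apply: (@fcodim_trans _ Y1) => //.
  exact: subspI.
by apply: fcodimS f2.
Qed.

Lemma fcodim_all (I : eqType) (s : seq I) Z (Y : I -> set V) : subsp Z ->
  (forall i, subsp (Y i)) -> (forall i, fcodim Z (Y i)) ->
  fcodim Z [set z | forall i, i \in s -> Y i z].
Proof.
move=> sZ sY fY; elim: s => [|j s IH].
  by apply: fcodimS (fcodimxx sZ) => // z _ i; rewrite in_nil.
have sYs : subsp [set z | forall i, i \in s -> Y i z].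
  split=> [i _|a u v hu hv i si]; first by case: (sY i).
  by case: (sY i) => _; apply; [apply: hu|apply: hv].
apply: fcodimS (fcodimI sZ (subspI sZ (sY j)) sYs _ _ IH) => //.
- move=> z [Zz [[_ Yj] Ys]] i; rewrite inE => /orP[/eqP->//|]; exact: Ys.
- by apply: fcodimS (fY j).
Qed.

(** Plays the role of Zorn's lemma: each strict enlargement inside [Z] lowers the codimension, so
    enlarging stops. *)
Lemma ex_maximal (P : set (set V)) B0 Z : (forall B, P B -> subsp B) -> P B0 ->
  fcodim Z B0 ->
  exists B, [/\ P B, B0 `<=` B & forall B', P B' -> B `<=` B' -> B' `&` Z `<=`
    B].
Proof.
move=> sP PB0 [n]; elim: n B0 PB0 => [|n IH] B PB hB;
  (have [max|/existsNP[B' /not_implyP[PB' /not_implyP[BB']]]] :=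
    pselect (forall B', P B' -> B `<=` B' -> B' `&` Z `<=` B);
      first by exists B; split);
  move=> /existsNP[a /not_implyP[[B'a Za] nBa]];
  have [//] := codim_le_grow Za BB' (sP _ PB) (sP _ PB') B'a nBa hB.
move=> _ /(IH _ PB')[B'' [? /(subset_trans BB') ? ?]].
by exists B''.
Qed.

End FiniteCodimension.

(** * Eigenvectors and nilpotency on finite-dimensional quotients *)

Section Eigenvectors.
Context (K : numClosedFieldType) (V : lmodType K) (T : V -> V).
Hypothesis linT : linear T.
Implicit Types (W Y Z : set V).

Lemma eigenvector_mod Z Y : subsp Z -> subsp Y -> fcodim Z Y ->
  (forall z, Z z -> Z (T z)) -> (forall y, Y y -> Y (T y)) -> ~ Z `<=` Y ->
  exists kap z, [/\ Z z, ~ Y z & Y (T z - kap *: z)].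
Proof.
move=> sZ sY [n /codim_le_basis[//|//|k [e [Ze indep span]]]] TZ TY ZY.
have k0 : (0 < k)%N.
  case: k e Ze indep span => // e _ _ span; case: ZY => z /span[c].
  by rewrite big_ord0 subr0.
have /choice[C hC] i := span _ (TZ _ (Ze i)).
have [kap /eigenvalueP[v vA v0]] := eigenvalue_closed (\matrix_i C i) k0.
exists kap, (\sum_i v 0 i *: e i); split.
- by apply: subsp_sum => // i; apply: subspZ.
- by move/indep/eqP; apply/negP.
rewrite linear_comb//.
rewrite (_ : _ - _ = \sum_i v 0 i *: (T (e i) - \sum_j C i 0 j *: e j)).
  by apply: subsp_sum => // i; apply: subspZ.
under [RHS]eq_bigr do rewrite scalerBr scaler_sumr.
rewrite [RHS]sumrB exchange_big/=; congr (_ - _).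
rewrite scaler_sumr; apply: eq_bigr => j _.
under eq_bigr do rewrite scalerA.
have /rowP/(_ j) := vA; rewrite !mxE => vAj.
rewrite -scaler_suml scalerA -vAj; congr (_ *: _).
by apply: eq_bigr => i _; rewrite mxE.
Qed.

(** The preimages of [W] under the powers of [T] increase and stabilize. If the last one is not
    everything, take an eigenvector modulo it: eigenvalue 0 contradicts stability, and a nonzero one
    gives, after applying T ^ p, an eigenvector excluded by hypothesis. *)
Lemma nilpotent_mod W : subsp W -> fcodim setT W -> (forall y, W y -> W (T y))
  ->
  (forall kap z, kap != 0 -> W (T z - kap *: z) -> W z) ->
  exists p, forall z, W (iter p T z).
Proof.
move=> sW fW TW noeig.
have linTp p : linear (iter p T).
  by elim: p => // p IH a u v; rewrite !iterS IH linT.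
pose X p := iter p T @^-1` W.
have [_ [[p _ <-] WX maxX]] : exists B, [/\ range X B, W `<=` B &
    forall B', range X B' -> B `<=` B' -> B' `&` setT `<=` B].
  apply: ex_maximal fW => [_ [p _ <-]|]; first exact: subsp_preim.
  by exists 0%N.
have XS q : X q `<=` X q.+1 by move=> z; rewrite /X/= => /TW.
have XqT q z : X q z -> X q (T z) by move=> /XS; rewrite /X/preimage/= -iterSr.
exists p; apply: contrapT => /existsNP[z0 nz0].
have [] := @eigenvector_mod setT (X p) => //.
- exact: subsp_preim.
- by apply: fcodimS fW => // z [_ /WX].
- exact: XqT.
- by move=> /(_ z0 I).
move=> kap [z [_ nXz Xz]]; have [k0|k0] := eqVneq kap 0.
  apply: nXz; apply: (maxX _ _ (XS p)); first by exists p.+1.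
  by split=> //; move: Xz; rewrite k0 scale0r subr0 /X/preimage/= -iterSr.
apply: nXz; apply: (noeig _ _ k0); move: Xz; rewrite /X/preimage/=.
rewrite addrC -scaleNr linTp scaleNr addrC -iterSr iterS.
by [].
Qed.

End Eigenvectors.

Section SubspaceType.
Context (K : fieldType) (V : lmodType K) (X : set V) (sX : subsp X).

(** The proof of [subsp X] is a parameter so that instance inference recovers it from the
    predicate. *)
Definition subspace_pred of subsp X : {pred V} := fun x => `[< X x >].

Lemma subspace_pred_closed : submod_closed (subspace_pred sX).
Proof.
split=> [|a u v /asboolP Xu /asboolP Xv]; apply/asboolP; first by case: sX.
by case: sX => _; apply.
Qed.

HB.instance Definition _ :=
  GRing.isSubmodClosed.Build K V (subspace_pred sX) subspace_pred_closed.

Definition subspace_type := {x : V | x \in subspace_pred sX}.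

HB.instance Definition _ := [isSub of subspace_type for @sval _ _].
HB.instance Definition _ := [Choice of subspace_type by <:].
HB.instance Definition _ :=
  [SubChoice_isSubLmodule of subspace_type by <:].

End SubspaceType.

(** * Lie algebras with a subalgebra of finite codimension *)

Section LieAlgebra.
Context (K : numClosedFieldType) (A : lmodType K) (br : A -> A -> A).
Hypothesis brl : forall c, linear (br^~ c).
Hypothesis brr : forall a, linear (br a).
Hypothesis brxx : forall a, br a a = 0.
Hypothesis jacobi :
  forall a b c, br a (br b c) + br b (br c a) + br c (br a b) = 0.
Implicit Types (a b c u v w x y z m : A) (s t : seq A) (M W X B H S : set A).

Lemma brDr a b c : br a (b + c) = br a b + br a c.
Proof. by have := brr a 1 b c; rewrite !scale1r. Qed.

Lemma brDl a b c : br (a + b) c = br a c + br b c.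
Proof. by have := brl c 1 a b; rewrite !scale1r. Qed.

Lemma brr0 a : br a 0 = 0.
Proof. by apply: (@addrI _ (br a 0)); rewrite -brDr !addr0. Qed.

Lemma br0r a : br 0 a = 0.
Proof. by apply: (@addrI _ (br 0 a)); rewrite -brDl !addr0. Qed.

Lemma brZr k a b : br a (k *: b) = k *: br a b.
Proof. by have := brr a k b 0; rewrite brr0 !addr0. Qed.

Lemma brZl k a b : br (k *: a) b = k *: br a b.
Proof. by have := brl b k a 0; rewrite br0r !addr0. Qed.

Lemma brNr a b : br a (- b) = - br a b.
Proof. by rewrite -scaleN1r brZr scaleN1r. Qed.

Lemma brBr a b c : br a (b - c) = br a b - br a c.
Proof. by rewrite brDr brNr. Qed.

Lemma brC a b : br a b = - br b a.
Proof.
apply/eqP; rewrite -addr_eq0; apply/eqP.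
by have := brxx (a + b); rewrite brDl !brDr !brxx addr0 add0r.
Qed.

Lemma br_der x y z : br x (br y z) = br (br x y) z + br y (br x z).
Proof.
rewrite [br (br x y) z]brC [br x z in RHS]brC brNr -opprD.
by apply/eqP; rewrite -addr_eq0 [br z _ + _]addrC addrA jacobi.
Qed.

Definition subalg M := subsp M /\ forall a b, M a -> M b -> M (br a b).

Definition normalizer H : set A := [set x | forall h, H h -> H (br x h)].

Lemma subalg_normalizer H : subsp H -> subalg (normalizer H).
Proof.
move=> sH; split; [split|].
- by move=> h Hh; rewrite br0r; case: sH.
- move=> a u v nu nv h Hh; rewrite brl.
  by apply: subspD => //; [apply: subspZ => //; apply: nu|apply: nv].
move=> a b na nb h Hh.
have := br_der a b h => /esym/(canRL (addrK _)) ->.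
by apply: subspB => //; [apply/na/nb|apply/nb/na].
Qed.

Fixpoint act s c := if s is x :: s' then br x (act s' c) else c.

Lemma act_cat s t c : act (s ++ t) c = act s (act t c).
Proof. by elim: s => //= x s ->. Qed.

Lemma act_rcons s x c : act (rcons s x) c = act s (br x c).
Proof. by rewrite -cats1 act_cat. Qed.

Lemma act_linear s : linear (act s).
Proof. by elim: s => //= x s IH a u v; rewrite IH brr. Qed.

Lemma actD s u v : act s (u + v) = act s u + act s v.
Proof. by have := act_linear s 1 u v; rewrite !scale1r. Qed.

Lemma actZ s k u : act s (k *: u) = k *: act s u.
Proof. by elim: s => //= x s ->; rewrite brZr. Qed.

Lemma actB s u v : act s (u - v) = act s u - act s v.
Proof. by rewrite actD -scaleN1r actZ scaleN1r. Qed.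

Definition letters S s := forall x, x \in s -> S x.

Lemma letters_cons S x s : letters S (x :: s) <-> S x /\ letters S s.
Proof.
split=> [h|[Sx h] y]; last by rewrite inE => /orP[/eqP->|/h].
by split=> [|y ys]; apply: h; rewrite inE ?eqxx ?ys ?orbT.
Qed.

Lemma letters_rcons S x s : letters S (rcons s x) <-> S x /\ letters S s.
Proof.
split=> [h|[Sx h] y]; last by rewrite mem_rcons inE => /orP[/eqP->|/h].
by split=> [|y ys]; apply: h; rewrite mem_rcons inE ?eqxx ?ys ?orbT.
Qed.

(** Bracket [l] with letters of [S] as long as the result stays outside [P]; the length is bounded,
    so this stops. *)
Lemma last_word S (P : set A) k l :
  (forall s, letters S s -> size s = k -> P (act s l)) -> ~ P l ->
  exists s, [/\ letters S s, ~ P (act s l)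
              & forall b, S b -> P (br b (act s l))].
Proof.
elim: k l => [|k IH] l hP nPl; first by case: nPl; apply: (hP [::]).
have [?|/existsNP[b /not_implyP[Sb nPb]]] :=
  pselect (forall b, S b -> P (br b l)).
  by exists [::].
have [s hs ks|s [hs nPs max]] := IH (br b l) _ nPb.
  by rewrite -act_rcons; apply: hP; rewrite ?size_rcons ?ks//;
    apply/letters_rcons.
exists (rcons s b); rewrite act_rcons; split=> //.
exact/letters_rcons.
Qed.

(** * Engel's theorem for the action of [M] on [A / W] *)

Section Engel.
Variables M W : set A.
Hypotheses (subM : subalg M) (sW : subsp W) (MW :
  forall m w, M m -> W w -> W (br m w)).
Hypothesis fW : fcodim setT W.

Definition nilpotent_on B k :=
  forall s, letters B s -> size s = k -> forall l, W (act s l).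

Lemma act_invariant s w : letters M s -> W w -> W (act s w).
Proof.
elim: s => //= x s IH /letters_cons[Mx Ms] Ww.
by apply: MW => //; apply: IH.
Qed.

Lemma nilpotent_on_le B k k' : B `<=` M -> (k <= k')%N ->
  nilpotent_on B k -> nilpotent_on B k'.
Proof.
move=> BM kk' hk s hs ks l; rewrite -(cat_take_drop (k' - k) s) act_cat.
apply: act_invariant => [x /mem_take/hs/BM//|].
by apply: hk => [x /mem_drop/hs//|]; rewrite size_drop ks subKn.
Qed.

(* Expanding [ad b_1 ... ad b_n m] as an operator gives products with all the
   letters [b_i] on both sides of [m]; one side has at least [k] of them. *)
Lemma nilpotent_on_ad B k m : B `<=` M -> M m -> nilpotent_on B k ->
  forall s s1 s2 l, letters B s -> letters B s1 -> letters B s2 ->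
    (k.*2 <= size s1 + size s + size s2)%N ->
    W (act s1 (br (act s m) (act s2 l))).
Proof.
move=> BM Mm hk; elim=> [|b s IH] s1 s2 l /= hs hs1 hs2 ks.
  have [k1|k1] := leqP k (size s1); first exact: (nilpotent_on_le BM k1 hk).
  apply: act_invariant => [x /hs1/BM//|]; apply: MW => //.
  by apply: (nilpotent_on_le (k' := size s2) BM _ hk) => //; lia.
have [Bb Bs] := (letters_cons _ _ _).1 hs.
have := br_der b (act s m) (act s2 l) => /esym/(canRL (addrK _)) ->.
rewrite actB; apply: subspB => //.
  rewrite -act_rcons; apply: IH => //; first exact/letters_rcons.
  by rewrite size_rcons; lia.
apply: (IH s1 (b :: s2)) => //; first exact/letters_cons.
by rewrite /=; lia.
Qed.

(** Let [X j] consist of the vectors that all words of length [j] in [B] send into [W]. Then [B]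
    maps [X j.+1] into [X j], and [a] preserves each [X j] because [B, a] lies in [B]. Hence [p]
    letters of the enlarged algebra lower the index by one. *)
Lemma nilpotent_on_line B k a p : subalg B -> B `<=` M -> M a ->
  (forall b, B b -> B (br b a)) -> nilpotent_on B k ->
  (forall l, W (iter p (br a) l)) ->
  exists N, nilpotent_on (add_line B a) N.
Proof.
move=> [sB _] BM Ma Ba hk hp.
pose X j : set A := [set l | forall s, letters B s -> size s = j -> W (act s
  l)].
have XS j l : X j.+1 l -> forall b, B b -> X j (br b l).
  move=> Xl b Bb s hs sj; rewrite -act_rcons; apply: Xl.
    exact/letters_rcons.
  by rewrite size_rcons sj.
have SX j l : (forall b, B b -> X j (br b l)) -> X j.+1 l.
  move=> h s; case/lastP: s => // s b /letters_rcons[Bb hs].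
  by rewrite size_rcons act_rcons => -[]; apply: h.
have sX j : subsp (X j).
  split=> [s hs _|c u v hu hv s hs sj].
    by apply: act_invariant => [x /hs/BM//|]; case: sW.
  by rewrite act_linear; case: sW => _; apply; [apply: hu|apply: hv].
have WX j : W `<=` X j by move=> w Ww s hs _;
  apply: act_invariant => // x /hs/BM.
have aX j l : X j l -> X j (br a l).
  elim: j l => [|j IH] l Xl.
    by move=> [|//] _ _; apply: MW => //; apply: (Xl [::]).
  apply: SX => b Bb; rewrite br_der; apply: (subspD (sX j)).
    by apply: XS => //; apply: Ba.
  exact/IH/XS.
have XX j l : X j l -> X j.+1 l.
  by move=> Xl [//|b s] /letters_cons[Bb hs] [sj] /=; apply: MW;
    [exact: BM|exact: Xl].
(* Modulo [X j], every letter acts on [X j.+1] as a multiple of ad a. *)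
have step j l s : X j.+1 l -> letters (add_line B a) s ->
    X j.+1 (act s l) /\ exists d, X j (act s l - d *: iter (size s) (br a) l).
  move=> Xl; elim: s => [_|x s IH /letters_cons[/add_lineP[e Be] /IH[Xs [d
    hd]]]].
    by split=> //; exists 1; rewrite scale1r subrr; case: (sX j).
  have E : br x (act s l) = br (x - e *: a) (act s l) + e *: br a (act s l).
    by rewrite -brZl -brDl subrK.
  split; rewrite /= E.
    apply: (subspD (sX j.+1)); first exact/XX/XS.
    by apply: (subspZ _ (sX j.+1)); apply: aX.
  exists (e * d); rewrite -addrA; apply: (subspD (sX j)); first exact: XS.
  rewrite -scalerA -scalerBr -brZr -brBr.
  by apply: (subspZ _ (sX j)); apply: aX.
suff [N hN] : exists N, forall s, letters (add_line B a) s -> size s = N ->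
    forall l, X k l -> W (act s l).
  by exists N => s hs sN l; apply: hN => // t ht tk; apply: hk.
elim: (k) => [|j [N hN]].
  by exists 0%N => s _ /size0nil-> l Xl; apply: (Xl [::]).
exists (N + p)%N => s hs sN l Xl; rewrite -(cat_take_drop N s) act_cat.
apply: hN => [x /mem_take/hs//||].
  by rewrite size_take sN; case: ltnP => //; lia.
have [_ [d hd]] := step j l (drop N s) Xl (fun x xs => hs x (mem_drop xs)).
apply: (subspBr (sX j) hd); apply: (subspZ _ (sX j)); apply: WX.
by rewrite size_drop sN addKn.
Qed.

(** The kernel of the action of [M] on [A / W] is cut out by one condition for each vector of a
    basis of [A / W]. *)
Lemma fcodim_annihilator :
  fcodim M (M `&` [set m | forall l, W (br m l)]).
Proof.
have [n /codim_le_basis[//|//|k [e [_ _ span]]]] := fW.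
have sY (i : 'I_k) : subsp ((br^~ (e i)) @^-1` W) by apply: subsp_preim.
have : fcodim M [set m | forall i, i \in enum 'I_k -> W (br m (e i))].
  apply: fcodim_all => [|//|i]; first by case: subM.
  exact: fcodim_preim fW.
apply: fcodimS => //; first by case: subM.
move=> m [Mm We]; split=> // l; have [c Wl] := span l I.
rewrite -[l](subrK (\sum_i c 0 i *: e i)) brDr; apply: subspD => //.
  exact: MW.
rewrite linear_comb//; apply: subsp_sum => // i; apply: subspZ => //.
by apply: We; rewrite mem_enum.
Qed.

(** Take a maximal subalgebra [B] of [M] that acts nilpotently and contains the kernel of the
    action. By [nilpotent_on_ad], long words in [B] send [M] into [B]; so if [B] is not [M], some
    [a] of [M] outside [B] has [B, a] in [B], and adjoining [a] contradicts maximality. *)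
Lemma engel : (forall m, M m -> exists p, forall l, W (iter p (br m) l)) ->
  exists k, nilpotent_on M k.
Proof.
move=> hnil; have sM := subM.1.
pose P B := [/\ subalg B, B `<=` M & exists k, nilpotent_on B k].
have PB0 : P (M `&` [set m | forall l, W (br m l)]).
  split; last by exists 1%N => -[//|b [|//]] /letters_cons[[_ Wb] _] _ l;
    apply: Wb.
    split=> [|a b [Ma Wa] [Mb Wb]].
      apply: subspI => //; split=> [l|c u v hu hv l]; first by rewrite br0r;
        case: sW.
      by rewrite brl; case: sW => _; apply; [apply: hu|apply: hv].
    split=> [|l]; first exact: subM.2.
    have := br_der a b l => /esym/(canRL (addrK _)) ->.
    by apply: subspB => //; apply: MW.
  by move=> m [].
have PS B : P B -> subsp B by case=> -[].
have [B [[aB BM [k hk]] B0B maxB]] := ex_maximal PS PB0 fcodim_annihilator.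
have [MB|/existsNP[m /not_implyP[Mm nBm]]] := pselect (M `<=` B).
  by exists k => s hs; apply: hk => x /hs/MB.
have actM s : letters B s -> M (act s m).
  elim: s => //= b s IH /letters_cons[/BM Mb /IH Ms]; exact: subM.2.
have [s hs ks|s [hs nBa Ba]] := @last_word B B k.*2 m _ nBm.
  apply: B0B; split; first exact: actM.
  move=> l; apply: (@nilpotent_on_ad B k m BM Mm hk s [::] [::] l) => //.
  by rewrite /= ks addn0.
have [p hp] := hnil _ (actM _ hs); have Ma := actM _ hs.
case: nBa; apply: (maxB (add_line B (act s m))); last 2 first.
- exact: sub_add_line.
- by split=> //; apply: add_line_in; case: aB.
split; last exact: (nilpotent_on_line aB BM Ma Ba hk hp).
- split=> [|u v [b Bb [c _ <-]] [b' Bb' [c' _ <-]]].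
    by apply: subsp_add_line; case: aB.
  apply: sub_add_line; have sB := aB.1.
  rewrite brDl !brDr !brZl !brZr brxx !scaler0 addr0.
  apply: subspD => //; last first.
    by apply: subspZ => //; rewrite brC; apply: subspN => //; apply: Ba.
  apply: subspD => //; first exact: aB.2.
  by apply: subspZ => //; apply: Ba.
- move=> u [b /BM Mb [c _ <-]]; apply: subspD => //; exact: subspZ.
Qed.

(** Take a maximal proper [M]-invariant [H] above [W]. Nilpotency gives [a] outside [H] with [M, a]
    in [H]; adding its line keeps invariance, so the sum is everything. *)
Lemma engel_hyperplane k : nilpotent_on M k -> W <> setT ->
  exists H z, [/\ subsp H, W `<=` H, ~ H z, forall l, exists c :
    K, H (l - c *: z)
                & forall m l, M m -> H (br m l)].
Proof.
move=> hk /eqP/setTPn[z nWz].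
pose P H := [/\ subsp H, W `<=` H, forall m h, M m -> H h -> H (br m h) & H <>
  setT].
have PS H : P H -> subsp H by case.
have PW : P W by split=> // WT; apply: nWz; rewrite WT.
have [H [[sH WH MH /eqP/setTPn[h nHh]] _ maxH]] := ex_maximal PS PW fW.
have [s hs ks|s [hs nHa Ha]] := @last_word M H k h _ nHh.
  exact/WH/hk.
set a := act s h in nHa Ha.
have Mline m l : M m -> add_line H a l -> H (br m l).
  move=> Mm [y Hy [c _ <-]]; rewrite brDr brZr; apply: subspD => //.
    exact: MH.
  by apply: subspZ => //; apply: Ha.
have lineT : add_line H a = setT.
  apply: contrapT => neT; apply: nHa; apply: (maxH (add_line H a)).
  - split=> // [|w /WH|m l Mm /(Mline _ _ Mm)]; first exact: subsp_add_line.
      exact: sub_add_line.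
    exact: sub_add_line.
  - exact: sub_add_line.
  - by split=> //; apply: add_line_in.
exists H, a; split=> // [l|m l Mm]; first by apply/add_lineP; rewrite lineT.
by apply: Mline => //; rewrite lineT.
Qed.

(* The map sending [r] to [ad r : H -> A / H] has a nonzero kernel on [A / M],
   since [dim (H / M) < dim (A / M)]. *)
Lemma normalizer_hyperplane H z : W `<=` H -> M `<=` W -> subsp H -> ~ H z ->
  (forall l, exists c : K, H (l - c *: z)) -> (forall m l, M m -> H (br m l)) ->
  fcodim setT M -> exists2 r, normalizer H r & ~ M r.
Proof.
move=> WH MW' sH nHz span Ha fM; have sM := subM.1.
have MH : M `<=` H by move=> m /MW'/WH.
have [n /codim_le_basis[//|//|k [h [Hh indep spanH]]]] : fcodim H M.
  by apply: fcodimS fM => // x [].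
(* These k + 1 vectors are independent modulo [M], while normalizing [H] imposes one scalar
   condition for each of the [k] vectors [h j]. *)
pose e (i : 'I_k.+1) := if unlift ord0 i is Some j then h j else z.
have /choice[C hC] i : exists c :
  'rV_k, forall j, H (br (e i) (h j) - c 0 j *: z).
  have /choice[c hc] j := span (br (e i) (h j)).
  by exists (\row_j c j) => j; rewrite mxE.
have [r r0 rC] := row_kernel (\matrix_i C i).
exists (\sum_i r 0 i *: e i); last first.
  rewrite /e big_ord_recl unlift_none; under eq_bigr do rewrite liftK.
  move=> Mr.
  have r00 : r 0 ord0 = 0.
    apply: contrapT => /eqP r00; apply: nHz; apply: (subspZK sH r00).
    rewrite -[_ *: z](addrK (\sum_i r 0 (lift ord0 i) *: h i)).
    by apply: subspB => //; [exact: MH|apply: subsp_sum => // i; apply: subspZ].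
  move: Mr; rewrite r00 scale0r add0r => Mr.
  have /rowP rS : \row_i r 0 (lift ord0 i) = 0.
    by apply: indep; under eq_bigr do rewrite mxE.
  case/eqP: r0; apply/rowP => i; rewrite mxE;
    case: (unliftP ord0 i) => [j|] -> //.
  by have := rS j; rewrite !mxE.
move=> y Hy; have [d Md] := spanH y Hy.
rewrite -[y](subrK (\sum_i d 0 i *: h i)) brDr; apply: subspD => //.
  by rewrite brC; apply: subspN => //; apply: Ha.
rewrite linear_comb//; apply: subsp_sum => // j; apply: subspZ => //.
have -> : br (\sum_i r 0 i *: e i) (h j) = \sum_i r 0 i *: (br (e i) (h j) - C
  i 0 j *: z).
  rewrite (linear_comb _ _ (brl (h j))).
  under [RHS]eq_bigr do rewrite scalerBr scalerA.
  rewrite sumrB -scaler_suml [X in _ - X *: _](_ : _ = 0) ?scale0r ?subr0//.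
  have /rowP/(_ j) := rC; rewrite !mxE => rCj; rewrite -[RHS]rCj.
  by apply: eq_bigr => i _; rewrite mxE.
by apply: subsp_sum => // i; apply: subspZ.
Qed.

End Engel.

(* [cl] stands for topological closedness; when [A] is a subalgebra viewed as a
   type, it is closedness of the image in the ambient Banach space. *)
Variable cl : set A -> Prop.
Hypothesis cl_bigcap : forall (D : set (seq A)) (F : seq A -> set A),
  (forall s, cl (F s)) -> cl (\bigcap_(s in D) F s).
Hypothesis cl_br : forall a B, cl B -> cl (br a @^-1` B).
Hypothesis cl_sup : forall B B', subsp B -> subsp B' -> B `<=` B' ->
  fcodim setT B -> cl B -> cl B'.

(** An eigenvalue of ad m on [A / B]. In the Banach setting closedness of [B] bounds it by the norm
    of ad m; [bounded_spectrum] abstracts this. *)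
Definition eigenvalue_on_quotient m (kap : K) := exists B a,
  [/\ subsp B, cl B, forall b, B b -> B (br m b), ~ B a & B (br m a - kap *:
    a)].

Hypothesis bounded_spectrum : forall m (lam : K), lam != 0 ->
  exists p, forall kap, ~ (eigenvalue_on_quotient m kap /\
    eigenvalue_on_quotient m (kap + p%:R * lam)).

(** * The filtration defined by a subalgebra, and its graded dual *)

Section Filtration.
Variable M : set A.
Hypothesis subM : subalg M.
Let sM : subsp M := subM.1.

(** The strict inequality makes [level 0] the whole algebra and [level 1] equal to [M]. *)
Definition level n : set A := [set c | forall s, (size s < n)%N -> M (act s c)].

(* The word [s] annihilates the graded module [N] whose dual has the components
   [level n / level (n + 1)]. *)
Definition kills s := forall c, level (size s) c -> M (act s c).

Lemma levelS n c : level n.+1 c <-> M c /\ forall x, level n (br x c).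
Proof.
split=> [lc|[Mc lc] s].
  split=> [|x s sn]; first exact: (lc [::]).
  by rewrite -act_rcons; apply: lc; rewrite size_rcons.
case/lastP: s => // s x; rewrite size_rcons act_rcons => ?; exact: lc.
Qed.

Lemma level_le n k : (n <= k)%N -> level k `<=` level n.
Proof. by move=> nk c lc s sn; apply: lc; apply: leq_trans nk. Qed.

Lemma subsp_level n : subsp (level n).
Proof.
split=> [s _|a u v lu lv s sn].
  by have := actZ s 0 0; rewrite !scale0r => ->; case: sM.
by rewrite act_linear; case: sM => _; apply; [apply: lu|apply: lv].
Qed.

Lemma level_br n m c : M m -> level n c -> level n (br m c).
Proof.
move=> Mm; elim: n c => [//|n IH] c /levelS[Mc lc]; apply/levelS; split.
  exact: subM.2.
move=> x; rewrite br_der; apply: (subspD (subsp_level n)) => //; exact: IH.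
Qed.

Lemma level_act n s c : level (n + size s) c -> level n (act s c).
Proof.
by move=> lc t tn; rewrite -act_cat; apply: lc; rewrite size_cat ltn_add2r.
Qed.

(** Exchanging adjacent letters costs a word in which their bracket replaces both; it is one letter
    shorter, so the level of [c] puts its value in [M]. *)
Lemma act_swap s t x c : level (size s + size t).+1 c ->
  M (act (s ++ x :: t) c - act (s ++ t ++ [:: x]) c).
Proof.
elim: t s => [|y t IH] s lc; first by rewrite subrr; case: sM.
rewrite -[X in X - _](subrK (act (rcons s y ++ x :: t) c)) -addrA.
apply: (subspD sM).
  rewrite cat_rcons !act_cat /= -actB br_der addrK.
  rewrite -[act s _](act_cat s (br x y :: t)); apply: lc.
  by rewrite size_cat /= addnS.
by have := IH (rcons s y); rewrite size_rcons addSnnS (cat_rcons y s (t ++ _));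
  apply.
Qed.

Lemma act_perm s t c : perm_eq s t -> level (size s) c ->
  M (act s c - act t c).
Proof.
elim/last_ind: s t c => [|s x IH] t c.
  by rewrite perm_sym => /perm_nilP-> _; rewrite subrr; case: sM.
move=> st lc; have : x \in t by rewrite -(perm_mem st) mem_rcons inE eqxx.
move: st => /[swap] /splitPr[t1 t2] st.
have {}st : perm_eq s (t1 ++ t2).
  apply/permP => p; move/permP/(_ p): st.
  by rewrite -cats1 !count_cat /=; lia.
have : M (act s (br x c) - act (t1 ++ t2) (br x c)).
  apply: IH => //; move: lc; rewrite size_rcons => /levelS[_]; exact.
have : M (act (t1 ++ x :: t2) c - act (t1 ++ t2 ++ [:: x]) c).
  by apply: act_swap; move: lc; rewrite size_rcons (perm_size st) size_cat.
rewrite act_rcons catA [act (_ ++ [:: x]) c]act_cat /= => h1 h2.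
rewrite -[X in X - _](subrK (act (t1 ++ t2) (br x c))) -addrA.
by apply: (subspD sM) => //; rewrite -opprB; apply: subspN.
Qed.

Lemma kills_perm s t : perm_eq s t -> kills s -> kills t.
Proof.
move=> st ks c; rewrite -(perm_size st) => lc.
exact: subspBl sM (act_perm st lc) (ks c lc).
Qed.

Lemma kills_cat s t : kills s -> kills (s ++ t).
Proof.
move=> ks c lc; rewrite act_cat; apply: ks; apply: level_act.
by rewrite -size_cat.
Qed.

(** Move [m] to the outermost place: the other letters bring [c] into [M], and [M] is a
    subalgebra. *)
Lemma kills_mem m s : M m -> m \in s -> kills s.
Proof.
move=> Mm /perm_to_rem ms; rewrite perm_sym in ms; apply: (kills_perm ms).
by apply: (@kills_cat [:: m]) => c /levelS[Mc _]; apply: subM.2.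
Qed.

Lemma subsp_kills s : subsp [set x | kills (x :: s)].
Proof.
split=> [c _|a u v ku kv c lc] /=; first by rewrite br0r; case: sM.
rewrite brl; apply: (subspD sM); last exact: kv.
by apply: (subspZ _ sM); apply: ku.
Qed.

(** Killing is linear in the first letter, and every letter can be brought there. The word [t] in
    the induction collects the letters already taken from [S]. *)
Lemma kills_span S X q : (forall P, subsp P -> S `<=` P -> X `<=` P) ->
  (forall s, letters S s -> size s = q -> kills s) ->
  forall s, letters X s -> size s = q -> kills s.
Proof.
move=> SX kS s; rewrite -[s]cats0 => hs.
have : letters S ([::] : seq A) by [].
have {hs} : letters X s by move: hs; rewrite cats0.
elim: s [::] => [|x s IH] t /=; first by move=> _ ht; apply: kS.
move=> /letters_cons[Xx Xs] ht sq; move: x Xx; apply: (SX _ (subsp_kills _)).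
move=> x Sx; apply: (@kills_perm (s ++ x :: t)).
  by apply/permP => p; rewrite /= !count_cat /= addnCA.
apply: IH => //; first exact/letters_cons.
by rewrite -sq !size_cat /= addnS.
Qed.

Definition nil_subspace X k := forall s, letters X s -> size s = k -> kills s.

Lemma nil_subspace_le X k k' : (k <= k')%N ->
  nil_subspace X k -> nil_subspace X k'.
Proof.
move=> kk' hX s hs ks; rewrite -(cat_take_drop k s); apply: kills_cat.
by apply: hX => [x /mem_take/hs//|]; rewrite size_takel ?ks.
Qed.

(** By linearity each letter is in [X] or equal to [x]; among k + p letters there are [k] in [X] or
    [p] copies of [x]. *)
Lemma nil_subspace_line X k x p : nil_subspace X k -> kills (nseq p x) ->
  nil_subspace (add_line X x) (k + p).
Proof.
move=> hX hx; apply: (@kills_span (X `|` [set x])).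
  move=> P sP SP _ [y Xy [c _ <-]]; apply: subspD => //; first by apply: SP;
    left.
  by apply: subspZ => //; apply: SP; right.
move=> s hs sk; pose f y := `[< X y >].
have /permPl/kills_perm := perm_filterC f s; apply.
have := count_predC f s; rewrite -!size_filter sk => fs.
have [fk|fk] := leqP k (size (seq.filter f s)).
  apply: kills_cat; apply: (nil_subspace_le fk hX) => // y.
  by rewrite mem_filter => /andP[/asboolP].
have fp : all (pred1 x) (seq.filter (predC f) s).
  apply/allP => y; rewrite mem_filter => /andP[/asboolPn nXy /hs[//|->]].
  by rewrite /= eqxx.
apply: (@kills_perm (seq.filter (predC f) s ++ seq.filter f s));
  first by rewrite perm_catC.
apply: kills_cat; rewrite (all_pred1P _ _ fp).
have pf : (p <= size (seq.filter (predC f) s))%N.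
  by rewrite -(leq_add2l (size (seq.filter f s))) [leqRHS]fs leq_add2r ltnW.
by rewrite -(subnKC pf) nseqD; apply: kills_cat.
Qed.

(** The Leibniz rule for ad m on a word, [f] giving modulo [M] the term in which a letter is
    replaced by its bracket with [m]. The prefix [s] serves the induction. *)
Lemma act_leibniz m s t c (f : A -> A) :
  (forall z t1 t2, t = t1 ++ z :: t2 ->
     M (act (s ++ t1 ++ br m z :: t2) c - f z)) ->
  M (act s (br m (act t c) - act t (br m c)) - \sum_(z <- t) f z).
Proof.
elim: t s => [|x t IH] s h.
  rewrite big_nil subr0 subrr.
  by have := actZ s 0 0; rewrite !scale0r => ->; case: sM.
rewrite big_cons /= br_der -addrA -brBr actD.
have -> : act s (br (br m x) (act t c)) = act (s ++ br m x :: t) c.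
  by rewrite act_cat.
have -> : act s (br x (br m (act t c) - act t (br m c))) =
  act (rcons s x) (br m (act t c) - act t (br m c)) by rewrite act_rcons.
rewrite opprD addrACA; apply: (subspD sM); first exact: (h x [::] t).
by apply: IH => z t1 t2 tE; rewrite cat_rcons; apply: (h z (x :: t1));
  rewrite tE.
Qed.

(* With [y = [m, x]], the derivation [m] sends the killed word
   [x ^ (a + 1) y ^ b] to
   [(a + 1) x ^ a y ^ (b + 1) + b x ^ (a + 1) y ^ (b - 1) [m, y]]; after
   multiplication by [y] the second term is killed. *)
Lemma kills_derivation m x (a b : nat) : M m ->
  kills (nseq a.+1 x ++ nseq b (br m x)) ->
  kills (nseq a x ++ nseq b.+2 (br m x)).
Proof.
set y := br m x => Mm ks c; set s := nseq a.+1 x ++ _ in ks.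
set s' := nseq a x ++ nseq b.+1 y.
have ss' : nseq a x ++ nseq b.+2 y = rcons s' y.
  by rewrite -[b.+2]addn1 nseqD catA cats1.
rewrite ss' size_rcons act_rcons => lc1;
  have [_ /(_ y) lc] := (levelS _ _).1 lc1.
have sz : size s = size s' by rewrite !size_cat !size_nseq addnS.
(* The rule is applied at [y, c]. Modulo [M], a letter [x] contributes the word [s']; any other
   letter is [y] and contributes 0, because the extra [y] completes a copy of the killed word
   [s]. *)
pose f z := if z == x then act s' (br y c) else 0.
have h1 : M (act [::] (br m (act s (br y c)) - act s (br m (br y c)))
             - \sum_(z <- s) f z).
  apply: act_leibniz => z t1 t2 sE; rewrite /f; case: eqP => [zx|zx].
    have p : perm_eq (t1 ++ br m z :: t2) s'.
      apply/permP => q; move/(congr1 (count q)): sE.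
      rewrite /s /s' zx -/y !count_cat /= ?count_cat /= !count_nseq.
      by case: (q x); case: (q y); lia.
    by apply: (act_perm p); rewrite (perm_size p).
  rewrite subr0 -act_rcons.
  have : z \in s by rewrite sE mem_cat inE eqxx orbT.
  rewrite mem_cat !mem_nseq (negbTE (introN eqP zx)) andbF /= =>
    /andP[_ /eqP zy].
  suff /kills_perm : perm_eq (s ++ [:: br m z]) (rcons ([::] ++ t1 ++ br m z ::
    t2) y).
    apply; first exact: kills_cat.
    move: lc1; rewrite -sz sE !size_rcons !size_cat /=; apply.
  by apply/permP => q; rewrite sE -cats1 -zy !count_cat /= ?count_cat /=; lia.
have h2 : M (act [::] (br m (act s (br y c)) - act s (br m (br y c)))).
  apply: subspB => //; first by apply: subM.2 => //; apply: ks; rewrite sz.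
  by apply: ks; rewrite sz; apply: level_br.
have := subspBl sM h1 h2; rewrite -big_mkcond/= big_const_seq iter_addr_0.
(* The coefficient counts the letters [x] in [s]; it is positive, hence invertible in characteristic
   zero. *)
rewrite -scaler_nat; apply: subspZK => //.
by rewrite pnatr_eq0 count_cat /= eqxx.
Qed.

(** Each use of [kills_derivation] trades one [x] for two copies of [m, x]. *)
Lemma kills_br m x n : M m -> kills (nseq n x) -> kills (nseq n.*2 (br m x)).
Proof.
move=> Mm; rewrite -[nseq n x]cats0 -(addn0 n.*2).
rewrite -[[::]]/(nseq 0 (br m x)); move: 0%N.
elim: n => [//|n IH] b /(kills_derivation Mm)/IH.
by rewrite doubleS !addSn !addnS.
Qed.

Hypothesis fM : fcodim setT M.

(** Take [W] maximal. If a power of [x] kills, its line can be adjoined, so [x] is already in [W];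
    with [kills_br] this gives invariance under [M]. *)
Lemma maximal_nil_subspace : exists W k, [/\ subsp W, M `<=` W,
  forall m w, M m -> W w -> W (br m w), nil_subspace W k
  & forall x p, kills (nseq p x) -> W x].
Proof.
pose P W := [/\ subsp W, M `<=` W & exists k, nil_subspace W k].
have PS W : P W -> subsp W by case.
have PM : P M.
  split=> //; exists 1%N => -[//|x [|//]] /letters_cons[Mx _] _.
  by apply: (kills_mem Mx); rewrite inE.
have [W [[sW MW [k hk]] _ maxW]] := ex_maximal PS PM fM.
have Wp x p : kills (nseq p x) -> W x.
  move=> hx; apply: (maxW (add_line W x)).
  - split; [exact: subsp_add_line|exact: subset_trans (@sub_add_line _ _ _ _)|].
    by exists (k + p)%N; apply: nil_subspace_line.
  - exact: sub_add_line.
  - by split=> //; apply: add_line_in.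
exists W, k; split=> // m w Mm Ww; apply: (Wp _ k.*2); apply: kills_br => //.
by apply: hk; [move=> x /nseqP[->]|rewrite size_nseq].
Qed.

(** Since [M] preserves [level n], passing to the next level only adds membership in [M] and one
    condition for each vector of a basis of [A / M]. *)
Lemma fcodim_level n : fcodim setT (level n).
Proof.
have [k /codim_le_basis[//|//|d [e [_ _ span]]]] := fM.
elim: n => [|n IH]; first by exists 0%N => z _; exists (const_mx 1);
  [apply/eqP => /rowP/(_ 0); rewrite !mxE; apply/eqP/oner_neq0|].
have sn := subsp_level n.
have f1 : fcodim setT (M `&` level n) by apply: fcodimI.
have f2 : fcodim setT [set c | forall i, i \in enum 'I_d -> level n (br (e i)
  c)].
  apply: fcodim_all => [//|i|i]; first exact: (subsp_preim (brr (e i)) sn).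
  exact: (fcodim_preim (brr (e i)) _ IH).
have sM2 := subspI sM sn.
have f3 := fcodimI _ sM2 _ _ f1 f2.
apply: fcodimS (f3 _ _ _) => //.
- move=> c [_ [[Mc lc] le]]; apply/levelS; split=> // x;
    have [r Mr] := span x I.
  rewrite -[x](subrK (\sum_i r 0 i *: e i)) brDl; apply: (subspD sn).
    exact: level_br.
  rewrite (linear_comb _ _ (brl c)); apply: subsp_sum => // i;
    apply: (subspZ _ sn).
  by apply: le; rewrite mem_enum.
split=> [i _|a u v hu hv i ei]; first by rewrite brr0; case: sn.
by rewrite brr; case: sn => _; apply; [apply: hu|apply: hv].
Qed.


Lemma solution_closed D : cl M -> cl (\bigcap_(s in D) (act s @^-1` M)).
Proof.
move=> clM; apply: cl_bigcap => s; move: M clM; elim: s => // x s IH B clB.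
exact: IH (cl_br x clB).
Qed.

Lemma subsp_solution D : subsp (\bigcap_(s in D) (act s @^-1` M)).
Proof. by apply: subsp_bigcap => s _; apply: subsp_preim => //;
  apply: act_linear. Qed.

(* [Z / level p] is dual to the degree [p] part of [N / W N], and [Y] is the
   kernel in [Z] of the transpose of [x ^ p]. *)
Lemma eigenvector_in_nil_subspace W k m x lam : cl M -> subsp W -> M `<=` W ->
  (forall m w, M m -> W w -> W (br m w)) -> nil_subspace W k ->
  (forall x p, kills (nseq p x) -> W x) ->
  M m -> lam != 0 -> W (br m x - lam *: x) -> W x.
Proof.
move=> clM sW MW brW nilW killsW Mm lam0 Wx; apply: contrapT => nWx.
have [p hp] := bounded_spectrum m lam0.
pose meets s := exists2 z, z \in s & W z.
pose E r j := exists s, [/\ size s = j, letters W s & ~ kills (nseq r x ++ s)].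
(* [E r j] says that x ^ r W ^ j does not annihilate N. For j = 0 this holds for all [r], because
   [x] is outside [W]; it fails for j = k, so there is a last [j] before a failure. *)
have [j [Ej [r nEj]]] : exists j, (forall r, E r j) /\ exists r, ~ E r j.+1.
  apply: contrapT => h.
  have Ej : forall j r, E r j.
    elim=> [r|j IH r].
      by exists [::]; split=> //; rewrite cats0 => /killsW.
    by apply: contrapT => nE; apply: h; exists j; split=> //; exists r.
  have [s [sk Ws]] := Ej k 0%N; apply; exact: nilW.
have [s [sj Ws /existsNP[c /not_implyP[lc nMc]]]] := Ej (r + p)%N.
pose D : set (seq A) := [set s | (size s < p)%N \/ size s = p /\ meets s].
pose Z := \bigcap_(s in D) (act s @^-1` M).
pose Y := \bigcap_(s in D `|` [set nseq p x]) (act s @^-1` M).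
have sZ : subsp Z by apply: subsp_solution.
have sY : subsp Y by apply: subsp_solution.
have ZY c' : Z c' -> M (act (nseq p x) c') -> Y c'.
  by move=> Zc Mc t [/Zc//|->].
have YZ c' : Y c' -> Z c' by move=> Yc t Dt; apply: Yc; left.
have Yx c' : Y c' -> M (act (nseq p x) c') by move=> Yc; apply: Yc; right.
have brZ c' : Z c' -> Z (br m c').
  move=> Zc t [tp|[tp [w tw Ww]]].
    by apply: (@level_br p) => // t' tp'; apply: Zc; left.
  have := @act_leibniz m [::] t c' (fun=> 0); rewrite big1// subr0 => h.
  apply: subspBl sM (h _) _.
    move=> z t1 t2 tE; rewrite subr0; apply: Zc; right.
    rewrite tE !size_cat /= in tp *; split=> //; rewrite /meets /=.
    move: tw; rewrite tE mem_cat inE => /or3P[wt|/eqP wz|wt].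
    - by exists w => //; rewrite mem_cat wt.
    - by exists (br m z); [rewrite mem_cat inE eqxx orbT|rewrite -wz;
        apply: brW].
    - by exists w => //; rewrite mem_cat inE wt !orbT.
  by apply: subM.2 => //; apply: Zc; right; split=> //; exists w.
(* Each of the [p] letters [x] contributes [lam]; the errors [m, x] - lam x are in [W], and words of
   length [p] meeting [W] send [Z] into [M]. *)
have equivariant c' : Z c' -> M (br m (act (nseq p x) c')
    - (act (nseq p x) (br m c') + (p%:R * lam) *: act (nseq p x) c')).
  move=> Zc; rewrite opprD addrA.
  have := @act_leibniz m [::] (nseq p x) c' (fun=> lam *: act (nseq p x) c').
  rewrite big_const_seq iter_addr_0 count_predT size_nseq -scaler_nat scalerA.
  apply=> z t1 t2 tE; have zx : z = x.
    by have : z \in nseq p x by [rewrite tE mem_cat inE eqxx orbT];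
      move=> /nseqP[].
  rewrite tE zx /= -(subrK (lam *: x) (br m x)) !act_cat /= brDl brZl actD actZ.
  rewrite addrK -[act _ _](act_cat t1 (_ :: t2)).
  apply: Zc; right; have := congr1 size tE;
    rewrite !size_cat size_nseq /= => <-.
  by split=> //; exists (br m x - lam *: x) => //;
    rewrite mem_cat inE eqxx orbT.
have brY c' : Y c' -> Y (br m c').
  move=> Yc; have Zc := YZ _ Yc; apply: ZY; first exact: brZ.
  have h := subspBl sM (equivariant _ Zc) (subM.2 _ _ Mm (Yx _ Yc)).
  by rewrite -[act _ _](addrK ((p%:R * lam) *: act (nseq p x) c'));
    apply: subspB => //; apply: subspZ => //; apply: Yx.
have fY : fcodim Z Y.
  apply: fcodimS (fcodim_preim (Z' :=
    Z) (act_linear (nseq p x)) (fun z _ => I) fM) => //.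
  by move=> c' [Zc Mc]; apply: ZY.
(* The witness is x ^ r s c: words of length [p] meeting [W] send it into [M] by the choice of [r],
   but x ^ p does not. *)
have nZY : ~ Z `<=` Y.
  move=> /(_ (act (nseq r x ++ s) c)) h; apply: nMc.
  rewrite addnC nseqD -catA act_cat; apply/Yx/h => t Dt.
  rewrite /preimage /= -act_cat.
  have {}lc : level (p + size (nseq r x ++ s)) c.
    by move: lc; rewrite !size_cat !size_nseq; apply: level_le; lia.
  case: Dt => [tp|[tp [w wt Ww]]].
    by apply: lc; rewrite size_cat ltn_add2r.
  suff : kills (t ++ nseq r x ++ s) by apply; rewrite size_cat tp.
  have kw : kills (nseq r x ++ w :: s).
    apply: contrapT => nk; apply: nEj; exists (w :: s); split=> //=.
      by rewrite sj.
    exact/letters_cons.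
  have /perm_to_rem tw := wt.
  apply: kills_perm (kills_cat (t := rem w t) kw).
  apply/permP => q; move/permP/(_ q): tw; rewrite /= !count_cat /=; lia.
(* If [v] is an eigenvector modulo [Y] with eigenvalue [kap], then x ^ p v is one modulo [M] with
   eigenvalue kap + p lam. *)
have [kap [v [Zv nYv Yv]]] :=
  eigenvector_mod (brr m) sZ sY fY brZ brY nZY.
apply: (hp kap); split.
  exists Y, v; split=> //; exact: solution_closed.
exists M, (act (nseq p x) v); split=> //.
- by move=> b; apply: subM.2.
- by move=> /(ZY _ Zv).
rewrite scalerDl opprD addrA addrAC.
move: (equivariant _ Zv) (Yx _ Yv); rewrite actB actZ opprD addrA => h1 h2.
rewrite (_ : _ - _ = br m (act (nseq p x) v) - act (nseq p x) (br m v)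
  - (p%:R * lam) *: act (nseq p x) v + (act (nseq p x) (br m v) - kap *: act
      (nseq p x) v)).
  exact: subspD.
by rewrite addrA [X in _ = X + _ - _]addrAC subrK.
Qed.

End Filtration.

Theorem ideal_of_subalgebra M0 : subalg M0 -> cl M0 -> fcodim setT M0 ->
  M0 <> setT -> exists I, [/\ subsp I, forall a b, I b -> I (br a b), cl I,
    I <> setT & fcodim setT I].
Proof.
move=> aM0 clM0 fM0 M0T.
pose P M := [/\ subalg M, M0 `<=` M & M <> setT].
have PS M : P M -> subsp M by case=> -[].
have PM0 : P M0 by split.
have [M [[aM M0M MT] _ maxM]] := ex_maximal PS PM0 fM0; have sM := aM.1.
have fM : fcodim setT M by apply: fcodimS fM0 => // z [_ /M0M].
have clM : cl M by apply: cl_sup M0M _ clM0 => //; case: aM0.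
have [W [k [sW MW brW nilW killsW]]] := maximal_nil_subspace aM fM.
have fW : fcodim setT W by apply: fcodimS fM => // z [_ /MW].
have [WT|WT] := pselect (W = setT).
  (* Words of length k + 1 kill, so this level equals the next one and is an ideal; the index k + 1
     places it inside [M], hence it is proper. *)
  exists (level M k.+1).
  have lk c : level M k.+1 c -> level M k.+2 c.
    move=> lc s; rewrite ltnS leq_eqVlt => /orP[/eqP sk|]; last exact: lc.
    have ks : kills M s.
      by apply: (nil_subspace_le (leqnSn k) nilW _ sk) => x _; rewrite WT.
    by apply: ks; rewrite sk.
  split=> [|a b /lk /levelS[]//||lT|].
  - exact: subsp_level.
  - rewrite (_ : level M k.+1 = \bigcap_(s in [set s | (size s < k.+1)%N]) (act
      s @^-1` M)).
      exact: solution_closed.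
    by apply/seteqP; split=> [c lc s|c lc s]; apply: lc.
  - by apply: MT; apply/seteqP; split=> // c _;
      have : level M k.+1 c by [rewrite lT]; case/levelS.
  - exact: fcodim_level.
have [N hN] : exists N, nilpotent_on W M N.
  apply: engel => // m Mm; apply: nilpotent_mod => // [w|lam x lam0].
    exact: brW.
  exact: (eigenvector_in_nil_subspace aM fM clM sW MW brW nilW killsW Mm lam0).
have [H [z [sH WH nHz span MH]]] := engel_hyperplane sW brW fW hN WT.
have [r nr nMr] := normalizer_hyperplane aM WH MW sH nHz span MH fM.
have M0H : M0 `<=` H by move=> x /M0M/MW/WH.
have nT : normalizer H = setT.
  apply: contrapT => nT; apply: nMr; apply: (maxM (normalizer H)) => //.
    split=> //; first exact: subalg_normalizer.
    by move=> m /M0M Mm h _; apply: MH.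
  by move=> m Mm h _; apply: MH.
exists H; split=> //.
- by move=> a b Hb; have : normalizer H a by [rewrite nT]; apply.
- by apply: cl_sup M0H _ clM0 => //; case: aM0.
- by move=> HT; apply: nHz; rewrite HT.
- by apply: fcodimS fM0 => // x [_ /M0H].
Qed.

End LieAlgebra.

(** * Closed subspaces and bounded operators *)

Lemma is_subspaceE (K : numFieldType) (V : normedModType K) (X : set V) :
  is_subspace X <-> subsp X.
Proof.
split=> [[X0 hX]|[X0 hX]]; split=> [|a u v].
- exact/set_mem.
- by move=> /mem_set Xu /mem_set Xv; apply/set_mem/hX.
- exact/mem_set.
- by move=> /set_mem Xu /set_mem Xv; apply/mem_set/hX.
Qed.

Lemma fcodimE (K : numFieldType) (V : normedModType K) (Z Y : set V) :
  subsp Z -> subsp Y -> finite_codim Z Y <-> fcodim Z Y.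
Proof.
move=> sZ sY; split=> [[n [e _ he]]|[n /codim_le_basis[//|//|k [e [Ze indep
  span]]]]].
  by exists n; apply: (spanning_codim_le (e := e)) => // z /he[c [? _]];
    exists c.
exists k, e => // z Zz; have [c Yc] := span z Zz; exists c; split=> // c' Yc'.
apply/eqP; rewrite -subr_eq0; apply/eqP/indep.
under eq_bigr do rewrite !mxE scalerBl.
rewrite sumrB (_ : _ - _ = (z - \sum_i c' 0 i *: e i) - (z - \sum_i c 0 i *: e
  i)).
  exact: subspB.
by rewrite opprB [RHS]addrC addrA subrK.
Qed.

(** For [y] outside the sum, each [t] has a neighbourhood that works together with one of [y];
    compactness makes the latter uniform in [t]. *)
Lemma closed_add_compact (K : numFieldType) (V : normedModType K)
    (T : topologicalType) (Y : set V) (C : set T) (f : T -> V) :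
  closed Y -> compact C -> continuous f ->
  closed [set y + f t | y in Y & t in C].
Proof.
move=> clY /compact_near_coveringP covC cf y cly; apply: contrapT => nYC.
have nY t : C t -> (~` Y) (y - f t).
  by move=> Ct Yt; apply: nYC; exists (y - f t) => //; exists t => //;
    rewrite subrK.
have [t Ct|s [[a Ya [t Ct <-]] hs]] :=
  cly _ (covC V (nbhs y) (fun s t => (~` Y) (s - f t)) _ _).
  have h : (fun p : T * V => p.2 - f p.1) @ (t, y) --> y - f t.
    by apply: cvgB; [exact: cvg_snd|exact: (cvg_comp fst f cvg_fst (cf t))].
  have := h _ (open_nbhs_nbhs (conj (closed_openC clY) (nY t Ct))).
  by [].
by apply: (hs t Ct); rewrite addrK.
Qed.

Section ComplexNorm.
Context (R : realType) (V : normedModType R[i]).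

(** The norm takes values in [R[i]]; its real part gives access to infima and the archimedean
    property of [R]. *)
Definition rnorm (v : V) : R := complex.Re `|v|.

Lemma rnormE v : `|v| = (rnorm v)%:C.
Proof. by rewrite /rnorm RRe_real// normr_real. Qed.

Lemma rnorm_ge0 v : 0 <= rnorm v.
Proof. by rewrite -ler0c -rnormE. Qed.

Lemma rnormD u v : rnorm (u + v) <= rnorm u + rnorm v.
Proof. by have := ler_normD u v; rewrite !rnormE -rmorphD lecR. Qed.

Lemma rnormN v : rnorm (- v) = rnorm v.
Proof. by rewrite /rnorm normrN. Qed.

Lemma rnormZ (c : R[i]) v : rnorm (c *: v) = complex.Re `|c| * rnorm v.
Proof.
have cE : `|c| = (complex.Re `|c|)%:C by rewrite RRe_real// normr_real.
by have := normrZ c v; rewrite !rnormE {1}cE -rmorphM => /complexI.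
Qed.

Lemma closed_dist (Y : set V) z : closed Y -> ~ Y z ->
  exists2 d : R, 0 < d & forall y, Y y -> d <= rnorm (z - y).
Proof.
move=> clY nYz; have := open_nbhs_nbhs (conj (closed_openC clY) nYz).
move=> /nbhs_ballP[e /= e0 he]; have eE : e = (complex.Re e)%:C.
  by rewrite RRe_real// gtr0_real.
exists (complex.Re e); first by rewrite -ltcR -eE.
move=> y Yy; rewrite leNgt; apply/negP => dy; apply: (he y) => //.
by rewrite -ball_normE /= rnormE eE ltcR.
Qed.

Lemma scale_continuous {z : V} : continuous (fun t : R => t%:C *: z).
Proof.
move=> t; apply/cvgrPdist_lt => e e0.
have eE : e = (complex.Re e)%:C by rewrite RRe_real// gtr0_real.
have e'0 : 0 < complex.Re e by rewrite -ltcR -eE.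
have z1 : 0 < rnorm z + 1 by rewrite ltr_wpDl// rnorm_ge0.
near=> s; rewrite -scalerBl -rmorphB rnormE eE ltcR rnormZ.
have -> : complex.Re `|(t - s)%:C| = `|t - s|.
  by rewrite normc_def /= expr0n addr0 sqrtr_sqr.
apply: (@le_lt_trans _ _ (`|t - s| * (rnorm z + 1))).
  by rewrite ler_wpM2l// lerDl.
rewrite -ltr_pdivlMr//; near: s.
have d0 : 0 < complex.Re e / (rnorm z + 1) by rewrite divr_gt0.
by apply: filterS (nbhsx_ballx t _ d0) => s; rewrite -ball_normE.
Unshelve. all: by end_near. Qed.

(** If [z] is at distance at least [d] from [Y], the coefficient of [z] in a vector v of the sum has
    modulus at most |v| / d. Near a given point the coefficients stay in a compact box, and
    [closed_add_compact] applies. *)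
Lemma closed_add_line (Y : set V) z : subsp Y -> closed Y ->
  closed (add_line Y z).
Proof.
move=> sY clY; have [Yz|nYz] := pselect (Y z).
  rewrite (_ : add_line Y z = Y)//; apply/seteqP; split=> [_ [y Yy [c _ <-]]|].
    by apply: subspD => //; apply: subspZ.
  exact: sub_add_line.
have [d d0 hd] := closed_dist clY nYz.
have coef_bound y c : Y y -> complex.Re `|c| * d <= rnorm (y + c *: z).
  move=> Yy; have [->|c0] := eqVneq c 0.
    by rewrite normr0 mul0r rnorm_ge0.
  have -> : y + c *: z = c *: (z - - (c^-1 *: y)).
    by rewrite opprK scalerDr scalerA divff// scale1r addrC.
  rewrite rnormZ; apply: ler_wpM2l.
    by rewrite -ler0c RRe_real ?normr_real.
  by apply: hd; apply: (subspN sY); apply: (subspZ _ sY).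
(* Vectors within distance 1 of [y] have norm at most [rnorm y + 1]. *)
move=> y cly; pose N := (rnorm y + 1) / d.
pose f (p : R * R) : V := p.1%:C *: z + p.2%:C *: ('i *: z).
pose box : set (R * R) := `[- N, N] `*` `[- N, N].
have cf : continuous f.
  move=> [s t]; apply: cvgD.
    exact: (cvg_comp fst (fun s : R =>
      s%:C *: z) cvg_fst (@scale_continuous z s)).
  exact: (cvg_comp snd (fun t : R =>
    t%:C *: ('i *: z)) cvg_snd (@scale_continuous ('i *: z) t)).
have cbox : compact box by apply: compact_setX; apply: segment_compact.
have fE c : c *: z = f (complex.Re c, complex.Im c).
  by rewrite /f /= scalerA -scalerDl {1}[c]complexE mulrC.
suff /(closed_add_compact clY cbox cf)[a Ya [t _ <-]] :
    closure [set a + f t | a in Y & t in box] y.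
  by exists a => //; exists (t.1%:C + t.2%:C * 'i) => //;
    rewrite scalerDl -scalerA.
move=> U Uy.
have : nbhs y (U `&` ball y 1) by apply: filterI => //; apply: nbhsx_ballx.
move=> /cly[_ [[a Ya [c _ <-]] [Uc]]].
rewrite -ball_normE /= rnormE -[1]/(1%:C) ltcR => yc.
exists (a + c *: z); split=> //; exists a => //.
exists (complex.Re c, complex.Im c); last by rewrite -fE.
have cN : complex.Re `|c| <= N.
  rewrite ler_pdivlMr//; apply: (le_trans (coef_bound a c Ya)).
  rewrite -[a + _](subKr y); apply: (le_trans (rnormD _ _)).
  by rewrite rnormN lerD2l ltW.
have bnd (t : R) : `|t| <= complex.Re `|c| -> `[- N, N]%classic t.
  move=> tc; rewrite /= in_itv /= -ler_norml; exact: le_trans cN.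
split=> /=; apply: bnd; rewrite normc_def /=.
  by rewrite -sqrtr_sqr ler_sqrt ?lerDl ?sqr_ge0// addr_ge0 ?sqr_ge0.
by rewrite -sqrtr_sqr ler_sqrt ?lerDr ?sqr_ge0// addr_ge0 ?sqr_ge0.
Qed.

Lemma closed_fcodim (Y Z : set V) : subsp Y -> subsp Z -> Y `<=` Z ->
  fcodim Z Y -> closed Y -> closed Z.
Proof.
move=> + sZ + [n]; elim: n Y => [|n IH] Y sY YZ hY clY;
  have [ZY|/existsNP[a /not_implyP[Za Ya]]] := pselect (Z `<=` Y);
  do ?[by rewrite (_ : Z = Y)//; apply/seteqP];
  have [] := codim_le_grow Za (@sub_add_line _ _ Y a) sY (subsp_add_line _ sY)
    (add_line_in _ sY) Ya hY => // _ /= hn.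
apply: IH hn _; [exact: subsp_add_line| |exact: closed_add_line].
by move=> _ [y /YZ Zy [c _ <-]]; apply: subspD => //; apply: subspZ.
Qed.

(* The quotient norm on [V / Y] of an operator bounded by [C] is at most [C]. *)
Lemma eigenvalue_bound (Y : set V) (T : V -> V) (C : R) a (kap : R[i]) :
  linear T -> 0 < C -> (forall v, rnorm (T v) <= C * rnorm v) ->
  subsp Y -> closed Y -> (forall y, Y y -> Y (T y)) -> ~ Y a ->
  Y (T a - kap *: a) -> complex.Re `|kap| <= C.
Proof.
move=> linT C0 TC sY clY TY nYa Ya; rewrite leNgt; apply/negP => Ck.
set k := complex.Re `|kap| in Ck; have k0 := lt_trans C0 Ck.
have kap0 : kap != 0 by apply: contraTneq k0 => kap0;
  rewrite /k kap0 normr0 ltxx.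
pose S := [set rnorm (a - y) | y in Y].
have S0 : S !=set0 by exists (rnorm (a - 0)), 0 => //; case: sY.
have lbS : has_lbound S by exists 0 => _ [y _ <-]; apply: rnorm_ge0.
have [d d0 hd] := closed_dist clY nYa.
have infS : 0 < inf S.
  by apply: (lt_le_trans d0); apply: lb_le_inf => // _ [y Yy <-]; apply: hd.
suff : k / C * inf S <= inf S.
  by rewrite ger_pMl// ler_pdivrMr// mul1r leNgt Ck.
apply: lb_le_inf => // _ [y Yy <-].
rewrite mulrAC ler_pdivrMr// [leRHS]mulrC; apply: le_trans (TC _).
(* Chosen so that T (a - y) = kap (a - y'), whose norm is at least |kap| times the distance from [a]
   to [Y]. *)
pose y' := kap^-1 *: (T y - (T a - kap *: a)).
have Yy' : Y y' by apply: subspZ => //; apply: subspB => //; apply: TY.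
have -> : T (a - y) = kap *: (a - y').
  rewrite scalerBr scalerA divff// scale1r (linear_sub linT) opprB addrA.
  by rewrite [kap *: a + _]addrC subrK.
rewrite rnormZ; apply: ler_wpM2l; first exact: ltW.
by apply: ge_inf => //; exists y'.
Qed.

End ComplexNorm.

(** * Banach Lie algebras *)

Section BanachLie.
Context (R : realType) (L : banachLieType R).
Implicit Types (a b : L) (I M X Y Z : set L).

Lemma bracket_linearl b : linear (fun a : L => bracket a b).
Proof. by move=> k u v; apply: bracketDl. Qed.

Lemma bracket_linearr a : linear (bracket a).
Proof. by move=> k u v; apply: bracketDr. Qed.

Lemma bracket_der a b c :
  bracket a (bracket b c) = bracket (bracket a b) c + bracket b (bracket a c).
Proof.
exact: br_der bracket_linearl bracket_linearr (@bracketxx R L)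
  (@bracket_jacobi R L) a b c.
Qed.

Lemma bracket_rnorm a : exists2 C : R, 0 < C &
  forall b, rnorm (bracket a b) <= C * rnorm b.
Proof.
have [t t0 ht] := @bracket_bounded R L.
have tE : t = (complex.Re t)%:C by rewrite RRe_real// gtr0_real.
have t'0 : 0 < complex.Re t by rewrite -ltcR -tE.
have ta : 0 <= complex.Re t * rnorm a by rewrite mulr_ge0 ?rnorm_ge0// ltW.
exists (complex.Re t * rnorm a + 1) => [|b]; first by rewrite ltr_wpDl.
apply: (@le_trans _ _ (complex.Re t * rnorm a * rnorm b)).
  by have := ht a b; rewrite !rnormE tE -!rmorphM lecR.
by rewrite ler_wpM2r ?rnorm_ge0// lerDl.
Qed.

Lemma bracket_continuous a : continuous (bracket a).
Proof.
have [C C0 hC] := bracket_rnorm a.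
move=> b; apply/cvgrPdist_lt => e e0.
have eE : e = (complex.Re e)%:C by rewrite RRe_real// gtr0_real.
have e'0 : 0 < complex.Re e by rewrite -ltcR -eE.
have d0 : 0 < (complex.Re e / C)%:C :> R[i] by rewrite ltcR divr_gt0.
apply: filterS (nbhsx_ballx b _ d0) => c.
rewrite -ball_normE /= !rnormE ltcR ltr_pdivlMr// => bc.
rewrite eE ltcR; apply: le_lt_trans bc; rewrite mulrC.
by apply: le_trans (hC _); rewrite (linear_sub (bracket_linearr a)).
Qed.

Lemma closed_bracket_preim a X : closed X -> closed (bracket a @^-1` X).
Proof. by apply: preimage_closed => x _; apply: bracket_continuous. Qed.

Section Subalgebra.
Variable X : set L.
Hypotheses (algX : lie_subalgebra X) (clX : closed X).
Let sX : subsp X := (is_subspaceE X).1 algX.1.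
Let A : lmodType R[i] := subspace_type sX.

Lemma subspace_valP (u : A) : X (val u).
Proof. by have /asboolP := valP u. Qed.

Let inj_linear : linear (val : A -> L).
Proof. by move=> k u v; rewrite linearP. Qed.

Lemma sub_bracket_subproof (u v : A) :
  bracket (val u) (val v) \in subspace_pred sX.
Proof. by apply/asboolP/algX.2; apply: subspace_valP. Qed.

Definition sub_bracket (u v : A) : A :=
  exist _ (bracket (val u) (val v)) (sub_bracket_subproof u v).

Lemma finite_codim_ideal Y : lie_subalgebra Y -> closed Y -> Y `<=` X ->
  Y <> X -> finite_codim X Y ->
  exists I, [/\ lie_ideal X I, closed I, I <> X & finite_codim X I].
Proof.
move=> algY clY YX neY fY.
have sY := (is_subspaceE Y).1 algY.1.
have imE (B : set L) : B `<=` X -> (val : A -> L) @` (val @^-1` B) = B.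
  move=> BX; apply/seteqP; split=> [_ [u Bu <-]//|b Bb].
  have Xb : b \in subspace_pred sX by apply/asboolP/BX.
  by exists (exist _ b Xb).
have imT : (val : A -> L) @` setT = X.
  by rewrite -[RHS]imE//; congr (_ @` _); apply/seteqP; split=> u // _;
    apply: subspace_valP.
have bracketE u v : val (sub_bracket u v) = bracket (val u) (val v) by [].
pose cl (B : set A) := closed ((val : A -> L) @` B).
have [||||D F clF|u B clB|B B' sB sB' BB' fB clB|m lam lam0| | | | |I [sI brI
  clI IT fI]] :=
  @ideal_of_subalgebra _ A sub_bracket _ _ _ _ cl _ _ _ _ (val @^-1` Y).
- by move=> w k u v; apply: val_inj; rewrite !(bracketE, inj_linear) bracketDl.
- by move=> w k u v; apply: val_inj; rewrite !(bracketE, inj_linear) bracketDr.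
- by move=> u; apply: val_inj; rewrite bracketE bracketxx raddf0.
- move=> u v w; apply: val_inj.
  have valD (u' v' : A) : val (u' + v') = val u' + val v' by exact: raddfD.
  by rewrite !valD !bracketE bracket_jacobi raddf0.
- rewrite /cl (_ : _ @` _ = X `&` \bigcap_(s in D) ((val : A -> L) @` F s)).
    by apply: closedI => //; apply: closed_bigI => s _; apply: clF.
  apply/seteqP; split=> [_ [u Fu <-]|b [Xb Fb]].
    by split=> [|s Ds]; [apply: subspace_valP|exists u => //; apply: Fu].
  have Pb : b \in subspace_pred sX by apply/asboolP.
  exists (exist _ b Pb) => // s Ds; have [u Fu ub] := Fb s Ds.
  by rewrite (_ : exist _ _ _ = u)//; apply: val_inj.
- rewrite /cl (_ : _ @` _ = X `&` bracket (val u) @^-1` ((val : A -> L) @` B)).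
    by apply: closedI => //; apply: closed_bracket_preim.
  apply/seteqP; split=> [_ [v Bv <-]|b [Xb [v Bv vb]]].
    by split; [apply: subspace_valP|exists (sub_bracket u v)].
  have Pb : b \in subspace_pred sX by apply/asboolP.
  exists (exist _ b Pb) => //; rewrite /preimage /=.
  by rewrite (_ : sub_bracket _ _ = v)//; apply: val_inj.
- apply: (closed_fcodim _ _ _ _ clB); [exact: subsp_image..| |].
    by move=> _ [v /BB' Bv <-]; exists v.
  apply: fcodim_image => //; exact: fcodimS fB.
- have [C C0 hC] := bracket_rnorm (val m).
  have l0 : 0 < complex.Re `|lam|.
    by rewrite -ltcR RRe_real ?normr_real// normr_gt0.
  (* Two numbers of modulus at most [C] cannot differ by p lam once p |lam| > 2 C. *)
  pose p := Num.bound ((C + C) / complex.Re `|lam|).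
  have pC : C + C < p%:R * complex.Re `|lam|.
    by rewrite -ltr_pdivrMr// archi_boundP// divr_ge0 ?addr_ge0 ?ltW.
  exists p => kap [].
  have bound k : eigenvalue_on_quotient sub_bracket cl m k -> complex.Re `|k|
    <= C.
    move=> [B [u [sB clB mB nBu Bu]]].
    apply: (eigenvalue_bound (bracket_linearr (val m)) C0 hC (subsp_image
      inj_linear sB) clB (a := val u)).
    - by move=> _ [v Bv <-]; exists (sub_bracket m v) => //; apply: mB.
    - by move=> [v Bv] /val_inj vu; apply: nBu; rewrite -vu.
    - by exists (sub_bracket m u - k *: u) => //; rewrite linearB linearZ.
  move=> /bound k1 /bound k2; move: pC; rewrite ltNge => /negP; apply.
  have : `|p%:R * lam| <= `|kap + p%:R * lam| + `|kap|.
    by have := ler_normB (kap + p%:R * lam) kap; rewrite addrAC subrr add0r.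
  have ReD (x y : R[i]) : complex.Re (x + y) = complex.Re x + complex.Re y.
    by case: x y => [? ?] [].
  have ReMn (x : R[i]) n : complex.Re (x *+ n) = complex.Re x *+ n.
    by elim: n => [//|n IH]; rewrite !mulrS ReD IH.
  rewrite normrM normr_nat !mulr_natl lecE ReD ReMn => /andP[_].
  by move=> /le_trans; apply; apply: lerD => //; rewrite -mulr_natl.
- split; first exact: subsp_preim.
  by move=> u v Yu Yv; apply: algY.2.
- by rewrite /cl imE.
- by apply: (fcodim_preim inj_linear (Z := X)) => [u _|];
    [apply: subspace_valP|apply/fcodimE].
- move=> YT; apply: neY; rewrite -imT -YT imE//.
have imI : (val : A -> L) @` I `<=` X by move=> _ [u _ <-];
  apply: subspace_valP.
have sIm := subsp_image inj_linear sI.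
exists ((val : A -> L) @` I); split=> //.
- split=> //; first exact/is_subspaceE.
  move=> a _ Xa [u Iu <-]; have Pa : a \in subspace_pred sX by apply/asboolP.
  by exists (sub_bracket (exist _ a Pa) u) => //; apply: brI.
- move=> IX; apply: IT; apply/seteqP; split=> // u _.
  have : ((val : A -> L) @` I) (val u) by rewrite IX; apply: subspace_valP.
  by move=> [v Iv /val_inj <-].
- apply/fcodimE => //; have := fcodim_image inj_linear fI.
  by rewrite imT.
Qed.
End Subalgebra.
End BanachLie.

(** * Towers of sets *)

Section Tower.
Context (T : Type) (g : set T -> set T).
Hypothesis g_sub : forall X, g X `<=` X.
Implicit Types (X Y Z U : set T) (F : set (set T)).

(** Transfinite iteration of [g] without ordinals: intersections supply the limit stages, and the
    empty one supplies the start [setT]. *)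
Definition tower : set (set T) := smallest
  (fun P => (forall X, P X -> P (g X)) /\
            (forall F, F `<=` P -> P (\bigcap_(X in F) X))) set0.

Lemma tower_ind (P : set (set T)) : (forall X, P X -> P (g X)) ->
  (forall F, F `<=` P -> P (\bigcap_(X in F) X)) -> tower `<=` P.
Proof. by move=> Pg PI X tX; apply: tX; split=> //; exact: sub0set. Qed.

Lemma tower_step X : tower X -> tower (g X).
Proof. by move=> tX P hP; apply: hP.1.1; apply: tX. Qed.

Lemma tower_bigcap F : F `<=` tower -> tower (\bigcap_(X in F) X).
Proof. by move=> Ft P hP; apply: hP.1.2 => X /Ft; apply. Qed.

Lemma tower_bigcap_image (I : Type) (D : set I) (f : I -> set T) :
  (forall i, D i -> tower (f i)) -> tower (\bigcap_(i in D) f i).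
Proof.
move=> Df; rewrite -(bigcap_image D f id); apply: tower_bigcap.
by move=> _ [i /Df ? <-].
Qed.

Lemma towerT : tower setT.
Proof. by rewrite -(bigcap_set0 id); apply: tower_bigcap. Qed.

(** As in the Bourbaki-Witt argument: a step from strictly above [X] does not jump past [X]. *)
Let good X := forall Y, tower Y -> X `<=` Y -> ~ Y `<=` X -> X `<=` g Y.

Let good_dichotomy X : good X -> forall Y, tower Y -> X `<=` Y \/ Y `<=` g X.
Proof.
move=> gX; suff: tower `<=` tower `&` [set Y | X `<=` Y \/ Y `<=` g X].
  by move=> h Y /h[].
apply: tower_ind => [Y [tY XY]|F FP]; split.
- exact: tower_step.
- case: XY => [XY|YgX]; last by right; apply: subset_trans YgX.
  have [YX|YX] := pselect (Y `<=` X); last by left; apply: gX.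
  by right; rewrite (_ : Y = X)//; apply/seteqP.
- by apply: tower_bigcap => Y /FP[].
- have [h|/existsNP[Y /not_implyP[FY XY]]] :=
    pselect (forall Y, F Y -> X `<=` Y).
    by left=> x Xx Y FY; apply: (h Y).
  right; have [_ [//|YgX]] := FP _ FY.
  exact: subset_trans (bigcap_inf FY) YgX.
Qed.

(** Tower induction on [X]. If [Y] is strictly above an intersection, some member fails to contain
    [Y], and goodness of that member suffices. *)
Let tower_good X : tower X -> good X.
Proof.
suff: tower `<=` tower `&` good by move=> h /h[].
clear X; apply: tower_ind => [X [tX gX]|F FP]; split.
- exact: tower_step.
- move=> Y tY XY nYX; have [{}XY|//] := good_dichotomy gX tY.
  have [YX|YX] := pselect (Y `<=` X).
    by rewrite (_ : Y = X)//; apply/seteqP.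
  exact: subset_trans (@g_sub X) (gX Y tY XY YX).
- by apply: tower_bigcap => Y /FP[].
move=> Y tY FY nYF.
have [X [FX nYX]] : exists X, F X /\ ~ Y `<=` X.
  apply: contrapT => h; apply: nYF => y Yy X FX; apply: contrapT => nXy.
  by apply: h; exists X; split=> // YX; apply/nXy/YX.
have [tX gX] := FP _ FX.
have [XY|YgX] := good_dichotomy gX tY; last first.
  by case: nYX; apply: subset_trans (@g_sub X).
have [YX|_] := pselect (Y `<=` X).
  by case: nYX.
exact: subset_trans (bigcap_inf FX) (gX Y tY XY nYX).
Qed.

Lemma tower_dichotomy X Y : tower X -> tower Y -> X `<=` Y \/ Y `<=` g X.
Proof. by move=> /tower_good/good_dichotomy; apply. Qed.

Lemma tower_total : total_on tower subset.
Proof.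
move=> X Y tX tY; have [|YX] := tower_dichotomy tX tY; first by left.
by right; apply: subset_trans (@g_sub X).
Qed.

Lemma tower_fixpoint U Y : tower U -> g U = U -> tower Y -> U `<=` Y.
Proof.
move=> tU gU; suff: tower `<=` tower `&` [set Y | U `<=` Y].
  by move=> h /h[].
clear Y; apply: tower_ind => [Y [tY UY]|F FP]; split.
- exact: tower_step.
- have [YU|] := pselect (Y `<=` U); last exact: (tower_good tU tY UY).
  by rewrite /= (_ : Y = U) ?gU//; apply/seteqP.
- by apply: tower_bigcap => Z /FP[].
- by move=> x Ux Z /FP[_]; apply.
Qed.

(** This is the well-ordering by reverse inclusion. If the least term [U] above all of [F] were not
    in [F], then [F] would lie below [g U], so [U] would be a fixpoint, and fixpoints lie below
    every term. *)
Lemma tower_max F : F `<=` tower -> F !=set0 ->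
  exists2 X, F X & forall Y, F Y -> Y `<=` X.
Proof.
move=> Ft [Y0 FY0].
pose U := \bigcap_(X in [set X | tower X /\ forall Y, F Y -> Y `<=` X]) X.
have FU Y : F Y -> Y `<=` U by move=> FY y Yy X [_ h]; apply: (h Y).
have tU : tower U by apply: tower_bigcap => X [].
exists U => //; apply: contrapT => nFU.
have FgU Y : F Y -> Y `<=` g U.
  move=> FY; have [UY|//] := tower_dichotomy tU (Ft _ FY).
  by case: nFU; rewrite (_ : U = Y)//; apply/seteqP; split=> //; apply: FU.
have gU : g U = U.
  apply/seteqP; split=> //; apply: bigcap_inf; split=> //; exact: tower_step.
apply: nFU; rewrite (_ : U = Y0)//; apply/seteqP; split; last exact: FU.
exact: (tower_fixpoint tU gU (Ft _ FY0)).
Qed.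

Lemma tower_least : let U := \bigcap_(X in tower) X in tower U /\ g U = U.
Proof.
set U := \bigcap_(X in tower) X; have tU : tower U by apply: tower_bigcap.
split=> //; apply/seteqP; split=> //; apply: bigcap_inf; exact: tower_step.
Qed.

End Tower.

(** * Complete families and finite gaps *)

Section Families.
Context (K : numFieldType) (V : normedModType K).
Implicit Types (G C : set (set V)) (X Y Z : set V).

Lemma closed_span_id X : is_subspace X -> closed X -> closed_span X = X.
Proof.
move=> sX /closure_id clX; rewrite /closed_span [in RHS]clX; congr closure.
by apply/seteqP; split=> [x sx|x Xx Y [_]]; [apply: sx; split|exact].
Qed.

Lemma fam_sup_max G X : G X -> is_subspace X -> closed X ->
  (forall Y, G Y -> Y `<=` X) -> fam_sup G = X.
Proof.
move=> GX sX clX maxX; rewrite /fam_sup (_ : \bigcup_(Y in G) Y = X).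
  exact: closed_span_id.
by apply/seteqP; split=> [x [Y /maxX YX /YX]//|x Xx]; exists X.
Qed.

Lemma subspace_setT : is_subspace [set: V].
Proof. exact/is_subspaceE. Qed.

Lemma p_complete_bigcap G : G setT ->
  (forall F, F `<=` G -> G (\bigcap_(X in F) X)) -> p_complete G.
Proof.
move=> GT GI; apply/seteqP; split=> [X GX|X [[F [_ FG] <-]|->]].
- left; exists [set X]; first by split=> [|_ ->//]; exists X.
  by rewrite /fam_inf bigcap_set1.
- exact: GI.
- by rewrite (fam_sup_max GT)//; apply: subspace_setT.
Qed.

Lemma finite_gapE Z Y : subsp Z -> subsp Y ->
  finite_gap Z Y <-> finite_codim Z Y /\ ~ Z `<=` Y.
Proof.
move=> sZ sY; split=> [[n n0 h]|[[n h] ZY]]; last first.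
  exists n => //; case: n h => // -[e _ h]; case: ZY => z /h[c [+ _]].
  by rewrite big_ord0 subr0.
split=> [|ZY]; first by exists n.
have [e Ze he] := h; pose i := Ordinal n0.
have [c [_ uc]] := he 0 sZ.1.
have /uc c0 : Y (0 - \sum_j (0 : 'rV[K]_n) 0 j *: e j).
  rewrite big1 ?subr0 => [|j _]; first exact: sY.1.
  by rewrite mxE scale0r.
have /uc /rowP/(_ i) : Y (0 - \sum_j (delta_mx 0 i : 'rV[K]_n) 0 j *: e j).
  rewrite (bigD1 i)//= big1 => [|j ji]; last first.
    by rewrite mxE (negbTE ji) andbF scale0r.
  by rewrite mxE !eqxx scale1r addr0 sub0r; apply: subspN => //; apply/ZY/Ze.
by rewrite c0 !mxE !eqxx => /eqP; rewrite eq_sym oner_eq0.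
Qed.

(** By p-completeness there is a least member [Y0] containing [Z]; the member [Y1] across the gap
    below it cannot contain [Z]. *)
Lemma chain_gap C Z : p_complete C -> lower_finite_gap C ->
  fam_inf C = [set 0] -> fam_sup C = setT -> ~ Z `<=` [set 0] ->
  exists Y0 Y1, [/\ C Y0, C Y1, Z `<=` Y0, ~ Z `<=` Y1 & finite_gap Y0 Y1].
Proof.
move=> pC gapC infC supC Z0.
have CT : C setT by rewrite pC; right; rewrite supC.
pose D := [set Y | C Y /\ Z `<=` Y]; pose Y0 := fam_inf D.
have CY0 : C Y0.
  by rewrite pC; left; exists D => //; split=> [|Y []//]; exists setT.
have ZY0 : Z `<=` Y0 by move=> z Zz Y [_]; apply.
have [|Y1 [CY1 [Y10 nY01] gap]] := gapC _ CY0.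
  by rewrite infC => Y00; apply: Z0; rewrite -Y00.
exists Y0, Y1; split=> // ZY1; apply: nY01.
by apply: bigcap_inf.
Qed.

End Families.

(** * Frattini sequences and chains *)

Section Frattini.
Context (R : realType) (L : banachLieType R).
Implicit Types (I J M X Y Z F : set L).

Lemma PJ_sub M : PJ M `<=` M. Proof. by move=> x []. Qed.

Lemma PJ_sub_ideal M I : lie_ideal M I -> closed I -> I <> M ->
  finite_codim M I -> PJ M `<=` I.
Proof. by move=> idI clI IM fI x [_]; apply. Qed.

Definition closed_ideal I := closed I /\ lie_ideal setT I.

Lemma closed_PJ M : closed M -> closed (PJ M).
Proof. by move=> clM; apply: closedI => //; apply: closed_bigI => I []. Qed.

(** For [x] in [L] and an ideal [I] among those defining [PJ M], the vectors of [I] that ad x sends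
    into [I] form another such ideal. Hence [PJ M] is invariant under all of [L]. *)
Lemma closed_ideal_PJ M : closed_ideal M -> closed_ideal (PJ M).
Proof.
move=> [clM [/is_subspaceE sM _ brM]]; split; first exact: closed_PJ.
split=> //.
  apply/is_subspaceE/subspI => //; apply: subsp_bigcap => I [[sI _ _] _ _ _].
  exact/is_subspaceE.
move=> x a _ [Ma PJa]; split; first exact: brM.
move=> I [[/is_subspaceE sI IM brI] clI neI fI].
have sI' := subsp_preim (bracket_linearr x) sI.
have [] : (I `&` bracket x @^-1` I) a; last by [].
apply: PJa; split.
- split=> [|c []|m c Mm [Ic Ixc]]; first exact/is_subspaceE/subspI.
    by move=> /IM.
  split; first exact: brI.
  rewrite /preimage /= bracket_der.
  apply: subspD => //; last exact: brI.
  by apply: brI => //; apply: brM.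
- by apply: closedI => //; apply: closed_bracket_preim.
- by move=> IM'; apply: neI; apply/seteqP; split=> // c; rewrite -IM' => -[].
- apply/fcodimE => //; first exact: subspI.
  have fI' : fcodim M I by apply/fcodimE.
  apply: fcodimI => //.
  by apply: fcodim_preim fI'; [exact: bracket_linearr|move=> c Mc; apply: brM].
Qed.

Lemma closed_ideal_tower : tower (@PJ R L) `<=` closed_ideal.
Proof.
apply: tower_ind => [X|F FP]; first exact: closed_ideal_PJ.
split; first by apply: closed_bigI => X /FP[].
split=> //.
  by apply/is_subspaceE; apply: subsp_bigcap => X /FP[_ [/is_subspaceE]].
by move=> a b _ Fb X FX; have [_ [_ _]] := FP X FX; apply => //; apply: Fb.
Qed.

Lemma PJ_term_tower X : PJ_term X -> tower (@PJ R L) X.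
Proof.
move=> [W [le [S [wo [S0 SS Slim] [a <-]]]]]; apply: contrapT => nta.
pose bad := [pred w | `[< ~ tower (@PJ R L) (S w) >]].
have [|z [[/asboolP ntz minz] _]] := wo bad.
  by exists a; apply/asboolP.
have tot : total le.
  move=> x y; have [|u [[ux lu] _]] := wo [pred w | (w == x) || (w == y)].
    by exists x; rewrite inE /= eqxx.
  have lx : le u x by apply: lu; rewrite inE /= eqxx.
  have ly : le u y by apply: lu; rewrite inE /= eqxx orbT.
  by move: ux; rewrite inE => /orP[/eqP <-|/eqP <-]; rewrite ?lx ?ly ?orbT.
have tlt w : wo_lt le w z -> tower (@PJ R L) (S w).
  move=> [wz neq]; apply: contrapT => ntw; have zw : le z w by apply: minz;
    apply/asboolP.
  apply: neq; have [|u [_ uniq]] := wo [pred v | (v == w) || (v == z)].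
    by exists w; rewrite inE /= eqxx.
  have refl v : le v v by have := tot v v; rewrite orbb.
  have <- : u = w.
    apply: uniq; split; first by rewrite inE /= eqxx.
    by move=> v; rewrite inE => /orP[/eqP->|/eqP->].
  apply: uniq; split; first by rewrite inE /= eqxx orbT.
  by move=> v; rewrite inE => /orP[/eqP->|/eqP->].
apply: ntz.
have [z0|/existsNP[b /negP nzb]] := pselect (wo_zero le z).
  by rewrite S0//; exact: towerT.
have bz : wo_lt le b z.
  split; first by have := tot z b; rewrite (negbTE nzb).
  by move=> bz; move: nzb; rewrite bz => /negP; apply; have := tot z z;
    rewrite orbb.
have [lim|nlim] := pselect (wo_limit le z).
  by rewrite Slim//; apply: tower_bigcap_image.
(* An index that is neither zero nor a limit has an immediate predecessor. *)
have [c [cz nc]] : exists c, wo_lt le c z /\ forall d, ~ (wo_lt le c d /\ wo_lt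
  le d z).
  apply: contrapT => h; apply: nlim; split; first by exists b.
  move=> c cz; apply: contrapT => h'; apply: h; exists c; split=> // d hd.
  by apply: h'; exists d.
rewrite (SS c); first exact: tower_step (tlt _ cz).
split=> // d cd; apply: contrapT => nzd; apply: (nc d); split=> //; split.
  by have /orP[/nzd|] := tot z d.
by move=> dz; apply: nzd; rewrite dz; have := tot z z; rewrite orbb.
Qed.

(** The tower, ordered by reverse inclusion, indexes itself. *)
Lemma tower_PJ_term X : tower (@PJ R L) X -> PJ_term X.
Proof.
move=> tX; have PJs := PJ_sub.
pose W : eqType := {Y : set L | `[< tower (@PJ R L) Y >]}.
have tW (w : W) : tower (@PJ R L) (val w) by exact/asboolP/(valP w).
pose mk Y (tY : tower (@PJ R L) Y) : W := exist _ Y (asboolT tY).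
pose le (a b : W) := `[< val b `<=` val a >].
have ltE (a b : W) : wo_lt le a b <-> val b `<=` val a /\ ~ val a `<=` val b.
  split=> [[/asboolP ba ab]|[ba ab]]; split=> //; last first.
  - by move=> eab; apply: ab; rewrite eab.
  - exact/asboolP.
  - by move=> ab'; apply: ab; apply/val_inj/seteqP.
exists W, le, val; split; last by exists (mk X tX).
  apply: wochoice.antisymmetric_well_order =>
    [a b /andP[/asboolP ba /asboolP ab]|P [w Pw]].
    exact/val_inj/seteqP.
  have [||_ [v Pv <-] maxv] :=
      tower_max PJs (F := [set val v | v in [set v : W | v \in P]]).
  - by move=> _ [v _ <-].
  - by exists (val w), w.
  exists v; split=> // u Pu; apply/asboolP; apply: maxv.
  by exists u.
split=> [a a0|a b [/ltE[ba ab] minb]|a [_ lim]].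
- by have /asboolP Ta := a0 (mk _ (@towerT _ _)); apply/seteqP; split.
- have tPJ := tower_step (tW a).
  have nfix : ~ val a `<=` PJ (val a).
    move=> fix_a; apply: ab; apply: (tower_fixpoint PJs (tW a) _ (tW b)).
    by apply/seteqP; split=> //; apply: PJs.
  apply/seteqP; split.
    by have [|//] := tower_dichotomy PJs (tW a) (tW b).
  by have /asboolP := minb (mk _ tPJ) ((ltE a (mk _ tPJ)).2 (conj (@PJ_sub _)
    nfix)).
- set F := [set b | wo_lt le b a]; set U := \bigcap_(b in F) val b.
  have tU : tower (@PJ R L) U by apply: tower_bigcap_image.
  have aU : val a `<=` U by move=> x ax b /ltE[ab _]; apply: ab.
  apply/seteqP; split=> //; apply: contrapT => Ua.
  (* Otherwise [U] comes strictly before [a], and a term [c] lies strictly between them; but [c] is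
     one of the sets intersected in [U]. *)
  have [c [/ltE[cU Uc] ca]] := lim (mk U tU) ((ltE (mk U tU) a).2 (conj aU Ua)).
  by apply: Uc; apply: bigcap_inf.
Qed.

(** To evaluate [get], a stabilizing term must be exhibited; the least element of the tower is
    one. *)
Lemma frattini_tower : tower (@PJ R L) (@frattini_radical R L) /\
  PJ (@frattini_radical R L) = @frattini_radical R L.
Proof.
have [tU PU] := tower_least PJ_sub.
have [] : [set X : set L | PJ_term X /\ PJ X = X] (@frattini_radical R L).
  by apply: getPex; exists (\bigcap_(X in tower (@PJ R L)) X); split=> //;
    apply: tower_PJ_term.
by move=> /PJ_term_tower.
Qed.

(** * Closed subalgebras, two-step subideals and their gaps *)

Definition two_step_subideals : set (set L) :=
  [set I | closed I /\ two_step_subideal I].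

Definition subalgebras : set (set L) :=
  [set M | closed M /\ lie_subalgebra M].

Lemma lie_subalgebra_bigcap (G : set (set L)) : G `<=` @lie_subalgebra R L ->
  lie_subalgebra (\bigcap_(X in G) X).
Proof.
move=> GL; split=> [|a b Ga Gb X GX].
  by apply/is_subspaceE; apply: subsp_bigcap => X /GL[/is_subspaceE].
by have [_] := GL X GX; apply; [apply: Ga|apply: Gb].
Qed.

Lemma subalgebras_bigcap (G : set (set L)) : G `<=` subalgebras ->
  subalgebras (\bigcap_(X in G) X).
Proof.
move=> GS; split; first by apply: closed_bigI => X /GS[].
by apply: lie_subalgebra_bigcap => X /GS[].
Qed.

Lemma two_step_subideals_bigcap (G : set (set L)) : G `<=` two_step_subideals ->
  two_step_subideals (\bigcap_(X in G) X).
Proof.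
move=> GS; split; first by apply: closed_bigI => X /GS[].
split; first by apply: lie_subalgebra_bigcap => X /GS[_ []].
(* Intersecting all ideals that witness some member of [G] avoids choosing one for each. *)
exists (\bigcap_(J in [set J | lie_ideal setT J /\ exists2 I, G I & lie_ideal J
  I]) J).
  split=> //; first by apply/is_subspaceE;
    apply: subsp_bigcap => J [[/is_subspaceE sJ _ _] _].
  by move=> a b _ Jb J JG; have [[_ _ +] _] := JG; apply => //; apply: Jb.
have [sG _] : lie_subalgebra (\bigcap_(X in G) X).
  by apply: lie_subalgebra_bigcap => X /GS[_ []].
split=> [//|x Gx J [_ [I GI [_ IJ _]]]|a b Ja Gb I GI]; first by apply: IJ;
  apply: Gx.
have [_ [_ [J idJ idI]]] := GS I GI; have [_ _ brI] := idI.
by apply: brI; [apply: Ja; split=> //; exists I|apply: Gb].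
Qed.

Lemma two_step_subidealsT : two_step_subideals setT.
Proof. by rewrite -(bigcap_set0 id); apply: two_step_subideals_bigcap. Qed.

Lemma subalgebrasT : subalgebras setT.
Proof. by rewrite -(bigcap_set0 id); apply: subalgebras_bigcap. Qed.

Lemma two_step_subideals_subalgebras : two_step_subideals `<=` subalgebras.
Proof. by move=> I [clI [algI _]]. Qed.

Lemma subalgebras_subsp X : subalgebras X -> subsp X.
Proof. by move=> [_ [/is_subspaceE]]. Qed.

Lemma subspI0 X : subsp X -> X <> [set 0] -> ~ X `<=` [set 0].
Proof.
by move=> [X0 _] nX X0'; apply: nX; apply/seteqP; split=> // _ ->.
Qed.

Lemma ideal_two_step X I : lie_ideal setT X -> lie_ideal X I -> closed I ->
  two_step_subideals I.
Proof.
move=> idX idI clI; split=> //; have [sI IX brI] := idI; split;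
  last by exists X.
by split=> // a b /IX Xa; apply: brI.
Qed.

Lemma closed_subspace0 : closed [set 0 : L].
Proof.
exact/accessible_closed_set1/hausdorff_accessible/norm_hausdorff.
Qed.

Lemma two_step_subideals0 : two_step_subideals [set 0].
Proof.
have s0 : is_subspace [set 0 : L].
  by apply/is_subspaceE; split=> // k _ _ -> ->; rewrite scaler0 addr0.
have id0 X : is_subspace X -> lie_ideal X [set 0].
  move=> /is_subspaceE[X0 _]; split=> // [_ ->//|a _ _ ->].
  by have := linear_sub (bracket_linearr a) 0 0; rewrite !subrr.
exact: ideal_two_step (id0 _ (subspace_setT L)) (id0 _ s0) closed_subspace0.
Qed.

Lemma fam_inf0 (G : set (set L)) : G [set 0] -> G `<=` subalgebras ->
  fam_inf G = [set 0].
Proof.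
move=> G0 GS; apply/seteqP; split; first exact: bigcap_inf.
by move=> _ -> X /GS/subalgebras_subsp[].
Qed.

(** The ideal theorem enters here: a proper [Y] would yield a proper closed ideal of finite
    codimension containing [PJ X], that is, [X]. *)
Lemma fixpoint_no_gap X Y : subalgebras X -> PJ X = X -> subalgebras Y ->
  Y `<=` X -> finite_codim X Y -> Y = X.
Proof.
move=> [clX algX] PX [clY algY] YX fY; apply: contrapT => nYX.
have [I [idI clI neI fI]] := finite_codim_ideal algX clX algY clY YX nYX fY.
have := PJ_sub_ideal idI clI neI fI; rewrite PX => XI.
by have [_ IX _] := idI; apply: neI; apply/seteqP.
Qed.

(** The radical is a closed ideal fixed by [PJ], so it admits no gap and must vanish. *)
Lemma semisimple_of_gaps : (forall X, two_step_subideals X -> X <> [set 0] ->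
    exists Y, [/\ subalgebras Y, Y `<=` X, ~ X `<=` Y & finite_codim X Y]) ->
  frattini_semisimple L.
Proof.
move=> gaps; have [tF PF] := frattini_tower.
have [clF idF] := closed_ideal_tower tF.
apply: contrapT => nF; have [sF _ brF] := idF.
have idFF : lie_ideal (@frattini_radical R L) (@frattini_radical R L).
  by split=> // a b _; apply: brF.
have F2 := ideal_two_step idF idFF clF.
have [Y [aY YF FY fY]] := gaps _ F2 nF.
apply: FY; rewrite (fixpoint_no_gap _ PF aY YF fY)//.
exact: two_step_subideals_subalgebras.
Qed.

(* The least term [X] of the sequence containing [Z] satisfies
   [~ Z `<=` PJ X], so some ideal of [X] of finite codimension cuts [Z]. *)
Lemma semisimple_gaps : frattini_semisimple L ->
  forall Z, two_step_subideals Z -> Z <> [set 0] ->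
  exists Y, [/\ two_step_subideals Y, Y `<=` Z, ~ Z `<=` Y & finite_codim Z Y].
Proof.
rewrite /frattini_semisimple => F0 Z tZ nZ.
have [t0 P0] := frattini_tower; rewrite F0 in t0 P0.
pose X := \bigcap_(Y in [set Y | tower (@PJ R L) Y /\ Z `<=` Y]) Y.
have tX : tower (@PJ R L) X by apply: tower_bigcap => Y [].
have ZX : Z `<=` X by move=> z Zz Y [_]; apply.
have sZ := subalgebras_subsp (two_step_subideals_subalgebras tZ).
have nZP : ~ Z `<=` PJ X.
  move=> ZP; apply: (subspI0 sZ nZ); apply: (subset_trans ZX).
  apply: (tower_fixpoint PJ_sub tX _ t0); apply/seteqP; split;
    first exact: PJ_sub.
  by apply: bigcap_inf; split=> //; apply: tower_step.
have [I [idI clI neI fI] nZI] : exists2 I,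
    [/\ lie_ideal X I, closed I, I <> X & finite_codim X I] & ~ Z `<=` I.
  apply: contrapT => h; apply: nZP => z Zz; split; first exact: ZX.
  by move=> I hI; apply: contrapT => nIz; apply: h; exists I => // ZI;
    apply/nIz/ZI.
have [clX idX] := closed_ideal_tower tX; have I2 := ideal_two_step idX idI clI.
have sI := subalgebras_subsp (two_step_subideals_subalgebras I2).
have [/is_subspaceE sX _ _] := idX.
exists (Z `&` I); split.
- rewrite (_ : Z `&` I = \bigcap_(Y in [set Z; I]) Y);
    last by rewrite bigcap_setU !bigcap_set1.
  by apply: two_step_subideals_bigcap => Y [->|->].
- by move=> z [].
- by move=> ZI; apply: nZI => z /ZI[].
- apply/fcodimE => //; first exact: subspI.
  by move/(fcodimE sX sI): fI; apply: fcodimS.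
Qed.

(** Choose one gap [g Z] below each nonzero subideal; the tower of [g] is the chain. Its
    intersection is fixed by [g], hence zero. *)
Lemma chain_of_gaps : (forall Z, two_step_subideals Z -> Z <> [set 0] ->
    exists Y, [/\ two_step_subideals Y, Y `<=` Z, ~ Z `<=` Y & finite_codim Z
      Y]) ->
  exists C : set (set L), [/\ C `<=` two_step_subideals, complete_family C,
    lower_finite_gap C & chain_from_to C [set 0] setT].
Proof.
move=> gaps.
have /choice[g hg] Z : exists Y, Y `<=` Z /\ (two_step_subideals Z ->
    two_step_subideals Y /\ (Z <> [set 0] -> ~ Z `<=` Y /\ finite_codim Z Y)).
  have [[tZ nZ]|h] := pselect (two_step_subideals Z /\ Z <> [set 0]).
    by have [Y [tY YZ nZY fY]] := gaps Z tZ nZ; exists Y.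
  (* The default [g Z = Z] covers the zero subspace and the sets that are not subideals. *)
  by exists Z; split=> // tZ; split=> // nZ; case: h.
have g_sub Z : g Z `<=` Z by have [] := hg Z.
pose C := tower g.
have C2 : C `<=` two_step_subideals.
  apply: tower_ind => [Z tZ|F]; last exact: two_step_subideals_bigcap.
  by have [_ /(_ tZ)[]] := hg Z.
have Csub Z : C Z -> is_subspace Z.
  by move=> /C2/two_step_subideals_subalgebras/subalgebras_subsp/is_subspaceE.
have Ccl Z : C Z -> closed Z by move=> /C2[].
have [tU gU] := tower_least g_sub.
have inf0 : fam_inf C = [set 0].
  apply: contrapT => nU; have [_ /(_ (C2 _ tU))[_ /(_ nU)[]]] := hg (fam_inf C).
  by rewrite /fam_inf gU => + _; apply.
have supT : fam_sup C = setT.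
  by apply: fam_sup_max => //; [exact: towerT|exact: subspace_setT].
exists C; split=> //.
- split; first by apply: p_complete_bigcap; [exact: towerT|exact: tower_bigcap].
  apply/seteqP; split=> [Z CZ|Z [[F [F0 FC] <-]|->]]; last by rewrite /fam_inf;
    exact: tU.
    left; exists [set Z]; first by split=> [|_ ->//]; exists Z.
    by apply: fam_sup_max => //; [exact: Csub|exact: Ccl|move=> _ ->].
  (* For s-completeness: the closed span of a subfamily is its largest member. *)
  have [X FX maxX] := tower_max g_sub FC F0.
  have CX := FC _ FX.
  by rewrite (fam_sup_max FX)//; [exact: Csub|exact: Ccl].
- move=> Z CZ; rewrite inf0 => nZ.
  have [_ /(_ (C2 _ CZ))[_ /(_ nZ)[ZgZ fgZ]]] := hg Z.
  have CgZ : C (g Z) by apply: tower_step.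
  have pZ : g Z `<` Z by split; [exact: (g_sub Z)|].
  exists (g Z); split=> //.
  have subC X CX := (is_subspaceE X).1 (Csub X CX).
  exact: (finite_gapE (subC _ CZ) (subC _ CgZ)).2 (conj fgZ ZgZ).
- split=> //; first by exists setT; apply: towerT.
  exact: tower_total g_sub.
Qed.

(** Intersecting [Z] with the lower end of a gap of the chain that separates it keeps finite
    codimension. *)
Lemma chain_gaps (C : set (set L)) : C `<=` subalgebras -> complete_family C ->
  lower_finite_gap C -> chain_from_to C [set 0] setT ->
  forall Z, subalgebras Z -> Z <> [set 0] ->
  exists Y, [/\ subalgebras Y, Y `<=` Z, ~ Z `<=` Y & finite_codim Z Y].
Proof.
move=> CS [pC _] gapC [_ _ inf0 supT] Z aZ nZ; have sZ := subalgebras_subsp aZ.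
have [Y0 [Y1 [CY0 CY1 ZY0 nZY1 gap]]] :=
  chain_gap pC gapC inf0 supT (subspI0 sZ nZ).
have s0 := subalgebras_subsp (CS _ CY0);
  have s1 := subalgebras_subsp (CS _ CY1).
exists (Z `&` Y1); split.
- rewrite (_ : Z `&` Y1 = \bigcap_(Y in [set Z; Y1]) Y);
    last by rewrite bigcap_setU !bigcap_set1.
  by apply: subalgebras_bigcap => Y [->//|->]; apply: CS.
- by move=> z [].
- by move=> ZY; apply: nZY1 => z /ZY[].
- apply/fcodimE => //; first exact: subspI.
  by move/(finite_gapE s0 s1): gap => [/(fcodimE s0 s1) f _]; apply: fcodimS f.
Qed.

Lemma lower_finite_gap_of_gaps (G : set (set L)) : G `<=` subalgebras ->
  G [set 0] ->
  (forall Z, G Z -> Z <> [set 0] ->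
    exists Y, [/\ G Y, Y `<=` Z, ~ Z `<=` Y & finite_codim Z Y]) ->
  lower_finite_gap G.
Proof.
move=> GS G0 gaps Z GZ; rewrite fam_inf0// => nZ.
have [Y [GY YZ ZY fY]] := gaps Z GZ nZ; exists Y; split=> //.
by apply/finite_gapE => //; apply: subalgebras_subsp; apply: GS.
Qed.

Lemma gaps_of_lower_finite_gap (G : set (set L)) : G `<=` subalgebras ->
  G [set 0] -> lower_finite_gap G ->
  forall Z, G Z -> Z <> [set 0] ->
    exists Y, [/\ G Y, Y `<=` Z, ~ Z `<=` Y & finite_codim Z Y].
Proof.
move=> GS G0 gapG Z GZ nZ; have [|Y [GY [YZ ZY] gap]] := gapG Z GZ.
  by rewrite fam_inf0.
exists Y; split=> //; have sub X GX := subalgebras_subsp (GS X GX).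
by have [] := (finite_gapE (sub _ GZ) (sub _ GY)).1 gap.
Qed.

End Frattini.

Theorem theorem8p6 (R : realType) (L : banachLieType R) :
  [<-> frattini_semisimple L ;
       exists C : set (set L),
         [/\ C `<=` [set I | closed I /\ two_step_subideal I],
             complete_family C, lower_finite_gap C
           & chain_from_to C [set 0] setT] ;
       exists C : set (set L),
         [/\ C `<=` [set M | closed M /\ lie_subalgebra M],
             complete_family C, lower_finite_gap C
           & chain_from_to C [set 0] setT] ;
       p_complete [set I : set L | closed I /\ two_step_subideal I] /\
       lower_finite_gap [set I : set L | closed I /\ two_step_subideal I] ;
       p_complete [set M : set L | closed M /\ lie_subalgebra M] /\
       lower_finite_gap [set M : set L | closed M /\ lie_subalgebra M] ].
Proof.
have alg2 := @two_step_subideals_subalgebras R L.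
have t0 := two_step_subideals0 L; have a0 := alg2 _ t0.
have ss_gap (gapA : forall Z, subalgebras Z -> Z <> [set 0 : L] ->
    exists Y, [/\ subalgebras Y, Y `<=` Z, ~ Z `<=` Y & finite_codim Z Y]) :
    frattini_semisimple L.
  by apply: semisimple_of_gaps => X /alg2; apply: gapA.
tfae.
- by move=> /semisimple_gaps; apply: chain_of_gaps.
- by move=> [C [C2 cC gC chC]]; exists C; split=> //; apply: subset_trans alg2.
- move=> [C [CS cC gC chC]].
  have /semisimple_gaps gaps2 := ss_gap (chain_gaps CS cC gC chC).
  split; last exact: lower_finite_gap_of_gaps.
  by apply: p_complete_bigcap;
    [exact: two_step_subidealsT|exact: two_step_subideals_bigcap].
(* The route is through semisimplicity to a chain of subideals, whose gaps cut every closed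
   subalgebra. *)
- move=> [_ gap2].
  have /semisimple_gaps/chain_of_gaps[C [C2 cC gC chC]] : frattini_semisimple L.
    apply: semisimple_of_gaps => X tX nX.
    have [Y [tY ? ? ?]] := gaps_of_lower_finite_gap alg2 t0 gap2 tX nX.
    by exists Y; split=> //; apply: alg2.
  split; first by apply: p_complete_bigcap;
    [exact: subalgebrasT|exact: subalgebras_bigcap].
  apply: lower_finite_gap_of_gaps => //.
  exact: chain_gaps (subset_trans C2 alg2) cC gC chC.
- by move=> [_ gapA]; apply: ss_gap; apply: gaps_of_lower_finite_gap.
Qed.
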